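(* There exists a finitely branching countable MDP $\mathcal M$ of the form $(\mathcal M,F,r)$ described in the context (the Büchi example MDP with set of states $F$, equipped with the rewards $r(s\longrightarrow s')=+1$ if $s\in F$ and $r(s\longrightarrow s')=-1$ if $s\notin F$), hence with integer rewards in $\{+1,-1\}$, with initial state $s_0$ and with the step counter from $s_0$ implicit in the current state, such that, for the event $\varphi$ that the $\limsup$ of the sequence of transition rewards seen along the run is $\ge 0$: (1) $\sup_\sigma\mathcal P_{\mathcal M,s_0,\sigma}(\varphi)=1$ (supremum over all strategies), but (2) for every randomized Markov strategy $\sigma$ we have $\mathcal P_{\mathcal M,s_0,\sigma}(\varphi)=0$.
   Context: An MDP $\mathcal M$ consists of a countable set $S$ of states partitioned into controlled and random states; a transition relation $\longrightarrow\subseteq S\times S$ such that every state has at least one successor; a function assigning to each random state a probability distribution on its successors; and a reward function $r$ assigning a real number to each transition. It is finitely branching if every state has finitely many successors. A history is a finite path ending in a controlled state; a (general) strategy $\sigma$ maps each history ending in $s$ to a probability distribution on the successors of $s$; together with the start state it induces a probability measure $\mathcal P_{\mathcal M,s_0,\sigma}$ on infinite runs from $s_0$. A randomized Markov strategy is a strategy whose (possibly randomized) choices depend only on the current state and on the number of steps taken so far. That the step counter from $s_0$ is implicit in the current state means that, for each state $s$, all paths from $s_0$ to $s$ have the same length. The MDP in question is built as follows. For a set $F\subseteq S$ of states, let $\mathsf{GF}\,F$ be the event that the run visits $F$ infinitely often (the Büchi objective). It is known (Theorem 3 of Kiefer, Mayr, Shirmohammadi and Totzke, ''Büchi Objectives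 in Countable MDPs'', ICALP 2019, where the MDP is drawn in Figure 3) that there exist a finitely branching countable MDP $\mathcal M$ with initial state $s_0$, where the step counter from $s_0$ is implicit in the current state, and a subset $F\subseteq S$ of its states, such that $\sup_\sigma\mathcal P_{\mathcal M,s_0,\sigma}(\mathsf{GF}\,F)=1$, while $\mathcal P_{\mathcal M,s_0,\sigma}(\mathsf{GF}\,F)=0$ for every randomized Markov strategy $\sigma$. Take this $\mathcal M$ and $F$, and define the transition rewards by $r(s\longrightarrow s')=+1$ if $s\in F$ and $r(s\longrightarrow s')=-1$ if $s\notin F$; with these rewards the events $\varphi$ and $\mathsf{GF}\,F$ coincide on $\mathcal M$. *)

(* Defs.v *)
From HB Require Import structures.
From mathcomp Require Import all_boot all_order all_algebra.
From mathcomp Require Import all_classical all_reals all_analysis.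

Set Implicit Arguments.
Unset Strict Implicit.
Unset Printing Implicit Defensive.
Import Order.TTheory GRing.Theory Num.Theory.

Local Open Scope classical_set_scope.
Local Open Scope ring_scope.
Local Open Scope ereal_scope.

Record distr (R : realType) (T : choiceType) := Distr {
  mass :> T -> R;
  mass_ge0 : forall t, (0 <= mass t)%R;
  mass_total : \esum_(t in [set: T]) (mass t)%:E = 1 }.

(* Only the values of [prob] at random (that is, non-controlled) states and   *)
(* the values of [reward] at transitions are meaningful.                      *)
Record mdp (R : realType) := MDP {
  state :> countType;
  controlled : {pred state};
  trans : rel state;
  prob : state -> distr R state;
  reward : state -> state -> R;
  trans_succ : forall s, exists t, trans s t;
  prob_succ : forall s t, s \notin controlled ->
    prob s t != 0%R -> trans s t }.

Definition finitely_branching (R : realType) (M : mdp R) :=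
  forall s : M, finite_set [set t | trans s t].

(* A finite path is given by its first state [s] and the sequence [p] of the  *)
(* following states; its length is [size p].                                  *)
Definition step_counter_implicit (R : realType) (M : mdp R) (s0 : M) :=
  forall p q : seq M, path (@trans R M) s0 p -> path (@trans R M) s0 q ->
    last s0 p = last s0 q -> size p = size q.

Definition history (R : realType) (M : mdp R) (s : M) (p : seq M) : bool :=
  path (@trans R M) s p && (last s p \in @controlled R M).

(* Only the values of [choice_at] at histories are meaningful.                *)
Record strategy (R : realType) (M : mdp R) := Strategy {
  choice_at :> M -> seq M -> distr R M;
  choice_succ : forall s p t, history s p ->
    choice_at s p t != 0%R -> trans (last s p) t }.

Definition randomized_markov (R : realType) (M : mdp R) (sigma : strategy M) :=
  forall s p s' p', history s p -> history s' p' ->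
    size p = size p' -> last s p = last s' p' ->
    sigma s p =1 sigma s' p'.

Definition next_state (R : realType) (M : mdp R) (sigma : strategy M)
    (s : M) (p : seq M) : distr R M :=
  if last s p \in @controlled R M then sigma s p else prob (last s p).

(* The sets of sequences of states that are determined by a finite prefix     *)
(* form an algebra; runs carry the sigma-algebra it generates. The point [s0] *)
(* only serves to witness that the type of runs is inhabited.                 *)
Definition finite_prefix (S : Type) : set (set (nat -> S)) :=
  [set A | exists n, forall x y : nat -> S,
    (forall i, (i < n)%N -> x i = y i) -> A x -> A y].

Section prefix_algebra.
Context (S : countType) (s0 : S).

Definition prefix_algebra of S := nat -> S.
Local Notation T := (prefix_algebra s0).

HB.instance Definition _ := Choice.on T.
HB.instance Definition _ := isPointed.Build T (fun=> s0).

Let finite_prefix0 : @finite_prefix S set0.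
Proof. by exists 0%N. Qed.

Let finite_prefixU : setU_closed (@finite_prefix S).
Proof.
move=> A B [n An] [m Bm]; exists (maxn n m) => x y xy [Ax|Bx]; [left|right].
- by apply: An Ax => i ni; apply: xy; rewrite leq_max ni.
- by apply: Bm Bx => i mi; apply: xy; rewrite leq_max mi orbT.
Qed.

Let finite_prefixC : setC_closed (@finite_prefix S).
Proof.
move=> A [n An]; exists n => x y xy nAx Ay; apply: nAx.
by apply: An Ay => i ni; rewrite xy.
Qed.

HB.instance Definition _ := @isAlgebraOfSets.Build default_measure_display
  T (@finite_prefix S) finite_prefix0 finite_prefixU finite_prefixC.

End prefix_algebra.

Definition runs (S : countType) (s0 : S) :=
  g_sigma_algebraType (@measurable _ (prefix_algebra s0)).

HB.instance Definition _ (S : countType) (s0 : S) := Measurable.on (runs s0).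

(* Existence of the law of a process that starts in [s0] and, after the       *)
(* states [p], moves to a state chosen by [k p]. The content of a finitely    *)
(* determined set is the eventual value of [level m [::]]; it is countably    *)
(* subadditive because a violation at a prefix would persist along an         *)
(* infinite branch.                                                           *)
Section process_law.
Context (R : realType) (S : countType) (s0 : S) (k : seq S -> distr R S).
Local Notation T := (prefix_algebra s0).
Implicit Types (A B : set T) (p : seq S) (m n : nat).

Let weight p : R := (\prod_(i < size p) k (take i p) (nth s0 p i))%R.

Let weight_ge0 p : (0 <= weight p)%R.
Proof. by apply: prodr_ge0 => i _; exact: mass_ge0. Qed.

Let weight_rcons p t : weight (rcons p t) = (weight p * k p t)%R.
Proof.
rewrite /weight size_rcons big_ord_recr/= nth_rcons ltnn eqxx.
rewrite -cats1 take_size_cat//; congr (_ * _)%R; apply: eq_bigr => i _.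
by rewrite takel_cat ?(ltnW (ltn_ord i))// nth_cat ltn_ord.
Qed.

Let extend p : T := fun i => nth s0 (s0 :: p) i.

Let extend_rcons p t i : (i < (size p).+1)%N -> extend (rcons p t) i = extend p i.
Proof. by rewrite /extend -rcons_cons nth_rcons /= => ->. Qed.

Let determined n A := forall x y : T,
  (forall i, (i < n)%N -> x i = y i) -> A x -> A y.

Let determinedE n A x y : determined n A ->
  (forall i, (i < n)%N -> x i = y i) -> A x = A y.
Proof.
move=> An xy; apply/propext; split; apply: An => // i ni.
by rewrite xy.
Qed.

Let determined_leq n m A : (n <= m)%N -> determined n A -> determined m A.
Proof.
by move=> nm An x y xy; apply: An => i ni; apply/xy/(leq_trans ni).
Qed.

Fixpoint level m p A : \bar R :=
  if m is m'.+1 then \esum_(t in [set: S]) level m' (rcons p t) A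
  else if extend p \in A then (weight p)%:E else 0.

Let level_ge0 m p A : 0 <= level m p A.
Proof.
elim: m p => [|m IH] p /=; first by case: ifP; rewrite // lee_fin.
by apply: esum_ge0 => t _.
Qed.

Let esumZ (c : R) (d : distr R S) : (0 <= c)%R ->
  \esum_(t in [set: S]) (c * d t)%:E = c%:E.
Proof.
move=> c0; have d0 t : 0 <= (d t)%:E by rewrite lee_fin mass_ge0.
rewrite -[RHS]mule1 -(mass_total d) /esum -ereal_supZl//; last first.
  by apply/set0P; eexists; exists set0 => //; exact: fsets_set0.
congr ereal_sup; apply/seteqP; split=> [_ [X fX <-]|_ [_ [X fX <-] <-]].
  by exists (\sum_(t \in X) (d t)%:E); [exists X|rewrite ge0_mule_fsumr].
by exists X => //; rewrite ge0_mule_fsumr.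
Qed.

Let esum_nneseries (a : S -> nat -> \bar R) : (forall t i, 0 <= a t i) ->
  \esum_(t in [set: S]) \sum_(i <oo) a t i =
  \sum_(i <oo) \esum_(t in [set: S]) a t i.
Proof.
move=> a0; rewrite nneseries_esumT; last by move=> i; exact: esum_ge0.
under eq_esum do rewrite nneseries_esumT//.
rewrite !esum_esum//.
rewrite (@reindex_esum _ _ _ ([set: nat] `*`` fun=> [set: S]) _
  (fun z => (z.2, z.1)))//.
split=> //= [[i t] [j u] _ _ /= [-> ->]//|[t i] _].
by exists (i, t).
Qed.

Let level_stable n p m A : determined n A -> (n <= (size p).+1)%N ->
  level m p A = level 0 p A.
Proof.
move=> An; elim: m p => //= m IH p np.
under eq_esum => t _.
  rewrite IH ?size_rcons ?(leqW np)//=.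
  have -> : (extend (rcons p t) \in A) = (extend p \in A).
    apply: asbool_equiv_eq; rewrite (determinedE An (y := extend p))// => i ni.
    by rewrite extend_rcons// (leq_trans ni).
  rewrite weight_rcons.
  over.
case: ifP => _; first exact: esumZ.
by rewrite esum1.
Qed.

Let level_eventually n p m A : determined n.+1 A -> (n <= m)%N ->
  level m p A = level n p A.
Proof.
move=> An /subnK <-; rewrite addnC; move: (m - n)%N => {}m.
suff : forall l q, (n <= size q + l)%N -> level (l + m) q A = level l q A.
  by apply; rewrite leq_addl.
elim=> [q nq|l IH q nq].
  by rewrite add0n (level_stable _ An)//; rewrite addn0 in nq.
by rewrite addSn /=; apply: eq_esum => t _; rewrite IH// size_rcons addSnnS.
Qed.

Let content_at p A : \bar R := limn (fun m => level m p A).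

Let content_atS n p A : determined n.+1 A -> content_at p A = level n p A.
Proof.
move=> An; apply/cvg_lim => //; apply: cvg_near_cst.
by exists n => // m /= nm; exact: level_eventually.
Qed.

Let content_atE n p A : determined n A -> content_at p A = level n p A.
Proof. by move=> /(determined_leq (leqnSn n)); exact: content_atS. Qed.

Let content_at_ge0 p A : measurable A -> 0 <= content_at p A.
Proof. by move=> [n An]; rewrite (content_atE p An) level_ge0. Qed.

Let content_at_rcons p A : measurable A ->
  content_at p A = \esum_(t in [set: S]) content_at (rcons p t) A.
Proof.
move=> [n An]; rewrite (content_atE p (determined_leq (leqnSn n) An)) /=.
by apply: eq_esum => t _; rewrite (content_atE _ An).
Qed.

Let levelU m p A B : [disjoint A & B] ->
  level m p (A `|` B) = level m p A + level m p B.
Proof.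
move=> AB; elim: m p => [|m IH] p /=; last first.
  by rewrite -esumD//; apply: eq_esum => t _; rewrite IH.
rewrite in_setU; have [pA|] := boolP (extend p \in A); last by rewrite add0e.
rewrite /= ifF ?adde0//; apply/negbTE/negP => pB.
have : (A `&` B) (extend p) by split; exact/set_mem.
by rewrite (disj_set2P AB).
Qed.

Definition process_content A : \bar R :=
  if `[< measurable A >] then content_at [::] A else 0.


Let process_contentE A : measurable A -> process_content A = content_at [::] A.
Proof. by move=> mA; rewrite /process_content asboolT. Qed.

Let process_content_ge0 A : 0 <= process_content A.
Proof.
by rewrite /process_content; case: asboolP => // mA; exact: content_at_ge0.
Qed.

Let process_content0 : process_content set0 = 0.
Proof.
rewrite process_contentE; last exact: measurable0.
by rewrite (content_atE [::] (n := 0))//= in_set0.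
Qed.

Let process_content_semi_additive :
  measure_function.semi_additive process_content.
Proof.
apply/additive2P; first exact: process_content0.
move=> A B mA mB AB.
have [n An] := mA; have [m Bm] := mB.
rewrite !process_contentE//; last exact: measurableU.
have An' := determined_leq (leq_maxl n m) An.
have Bm' := determined_leq (leq_maxr n m) Bm.
have ABnm : determined (maxn n m) (A `|` B).
  by move=> x y xy [/(An' _ _ xy)|/(Bm' _ _ xy)]; [left|right].
rewrite (content_atE _ ABnm) (content_atE _ An') (content_atE _ Bm').
by rewrite levelU//; exact/disj_set2P.
Qed.

HB.instance Definition _ := isContent.Build _ T R process_content
  process_content_ge0 process_content_semi_additive.

Let content_at_sigma_subadditive A (F : (set T)^nat) : measurable A ->
  (forall i, measurable (F i)) -> A `<=` \bigcup_i F i ->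
  content_at [::] A <= \sum_(i <oo) content_at [::] (F i).
Proof.
move=> mA mF AF; rewrite leNgt; apply/negP => bad0.
pose bad p := \sum_(i <oo) content_at p (F i) < content_at p A.
have /boolp.choice[g badg] p : exists t, bad p -> bad (rcons p t).
  have [bp|?] := pselect (bad p); last by exists s0.
  apply: contrapT => /forallNP nbad; move: bp; rewrite /bad ltNge => /negP; apply.
  rewrite content_at_rcons//.
  under eq_eseriesr => i _ do rewrite content_at_rcons//.
  rewrite -esum_nneseries => [|t i]; last exact: content_at_ge0.
  by apply: le_esum => t _; rewrite leNgt; apply/negP => bt; apply: (nbad t).
pose P n := iter n (fun p => rcons p (g p)) [::].
have sP n : size (P n) = n by elim: n => //= n IH; rewrite size_rcons IH.
have badP n : bad (P n) by elim: n => //= n; exact: badg.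
pose x : T := fun i => extend (P i) i.
have extP N i : (i < N.+1)%N -> extend (P N) i = x i.
  elim: N => [|N IH]; first by rewrite ltnS leqn0 => /eqP ->.
  rewrite ltnS leq_eqVlt => /predU1P[->//|iN].
  by rewrite /= extend_rcons ?sP// IH.
have [n An] := mA.
have content_atP l N B : determined l B -> (l <= N)%N ->
    content_at (P N) B = if x \in B then (weight (P N))%:E else 0.
  move=> Bl lN; rewrite (content_atE _ Bl) (level_stable _ Bl) ?sP ?leqW//=.
  rewrite (_ : (extend (P N) \in B) = (x \in B))//.
  apply: asbool_equiv_eq; rewrite (determinedE Bl (y := x))// => i il.
  by rewrite extP// (leq_trans il)// leqW.
have sum_ge0 N : 0 <= \sum_(i <oo) content_at (P N) (F i).
  by apply: nneseries_ge0 => i _ _; exact: content_at_ge0.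
have [Ax|Ax] := pselect (A x); last first.
  have := badP n; rewrite /bad (content_atP _ _ _ An)// memNset//.
  by rewrite ltNge sum_ge0.
have [i _ Fix] := AF _ Ax; have [m Fm] := mF i.
have := badP (maxn n m); rewrite /bad ltNge => /negP; apply.
rewrite (content_atP _ _ _ An) ?leq_maxl// mem_set//.
have <- : content_at (P (maxn n m)) (F i) = (weight (P (maxn n m)))%:E.
  by rewrite (content_atP _ _ _ Fm) ?leq_maxr// mem_set.
rewrite nneseries_esumT => [|j]; last exact: content_at_ge0.
apply: esum_ge; exists [set i]; last by rewrite fsbig_set1.
by split; [exact: finite_set1|].
Qed.

Let process_content_sigma_subadditive :
  measurable_subset_sigma_subadditive process_content.
Proof.
move=> A F mF mA AF; rewrite process_contentE//.
under eq_eseriesr => i _ do rewrite process_contentE//.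
exact: content_at_sigma_subadditive.
Qed.

HB.instance Definition _ := Content_SigmaSubAdditive_isMeasure.Build _ R T
  process_content process_content_sigma_subadditive.

Let process_measure := measure_extension process_content.

Let process_measureE A : measurable A -> process_measure A = content_at [::] A.
Proof.
by move=> mA; rewrite -process_contentE//; exact: measurable_mu_extE.
Qed.

Let process_measureT : process_measure setT = 1.
Proof.
rewrite process_measureE; last exact: measurableT.
by rewrite (content_atE [::] (n := 0))//= in_setT /weight big_ord0.
Qed.

HB.instance Definition _ := Measure.on process_measure.
HB.instance Definition _ := Measure_isProbability.Build _ _ _
  process_measure process_measureT.

Lemma process_law_exists : exists P : probability (runs s0) R,
  forall p, P [set rho | forall i, (i <= size p)%N -> rho i = nth s0 (s0 :: p) i]
    = (\prod_(i < size p) k (take i p) (nth s0 p i))%:E.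
Proof.
exists process_measure => p; rewrite -/(weight p); set C := [set _ | _].
have Cp : determined (size p).+1 C.
  by move=> x y xy Cx i ip; rewrite -xy// Cx.
transitivity (content_at [::] C).
  by apply: process_measureE; exists (size p).+1.
have levelC m q : (size q + m)%N = size p ->
    level m q C = if q == take (size q) p then (weight p)%:E else 0.
  elim: m q => [|m IH] q.
    rewrite addn0 => qp /=; rewrite qp take_size.
    have [->|qNp] := eqVneq q p; first by rewrite mem_set.
    rewrite memNset// => Cq; case/eqP: qNp.
    apply: (eq_from_nth (x0 := s0) qp) => i.
    by rewrite qp => ip; have := Cq i.+1 ip.
  move=> qp; have qltp : (size q < size p)%N by rewrite -qp addnS ltnS leq_addr.
  rewrite /=; under eq_esum => t _.
    rewrite IH ?size_rcons ?addSnnS// (take_nth s0)// eqseq_rcons.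
    over.
  have [_|_] := eqVneq q; last by rewrite esum1.
  rewrite -[RHS](@esum_set1 _ _ (nth s0 p (size q)) (fun=> (weight p)%:E)).
    rewrite [RHS]esum_mkcond; apply: eq_esum => t _ /=.
    case: eqVneq => [->|tNp]; first by rewrite mem_set.
    by rewrite memNset//; exact/eqP.
  by rewrite lee_fin.
by rewrite (content_atS _ Cp) levelC//= take0 eqxx.
Qed.
End process_law.

Section mdp_law.
Context (R : realType) (M : mdp R) (s0 : M).

(* [P] is the law of the runs from [s0] under [sigma]: the set of runs that   *)
(* extend a finite sequence of states has the product of the one-step         *)
(* probabilities as its measure.                                              *)
Definition is_run_law (sigma : strategy M) (P : probability (runs s0) R) :=
  forall p : seq M,
    P [set rho | forall i, (i <= size p)%N -> rho i = nth s0 (s0 :: p) i]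
    = (\prod_(i < size p) next_state sigma s0 (take i p) (nth s0 p i))%:E.

Lemma run_law_exists sigma : exists P, is_run_law sigma P.
Proof. exact: (process_law_exists s0 (next_state sigma s0)). Qed.

Definition run_law (sigma : strategy M) : probability (runs s0) R :=
  sval (cid (run_law_exists sigma)).

Lemma run_lawP sigma : is_run_law sigma (run_law sigma).
Proof. exact: svalP. Qed.

(* Sequences of states that do not follow transitions have measure zero, so   *)
(* events are given as sets of arbitrary sequences of states.                 *)
Definition buchi (F : set M) : set (runs s0) :=
  [set rho | forall n, exists2 m, (n <= m)%N & F (rho m)].

Definition limsup_ge0 : set (runs s0) :=
  [set rho | 0 <= limn_esup (fun n => (reward (rho n) (rho n.+1))%:E)].

End mdp_law.

Arguments buchi {R M} s0 F%_classical_set_scope.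
Arguments limsup_ge0 {R M} s0.

(* Main.v *)
Require Import Defs.
From HB Require Import structures.
From mathcomp Require Import all_boot all_order all_algebra.
From mathcomp Require Import all_classical all_reals all_analysis.
From mathcomp Require Import ring lra zify.

Import Order.TTheory GRing.Theory Num.Theory.
Local Open Scope classical_set_scope.
Local Open Scope ring_scope.
Local Open Scope ereal_scope.

Set Implicit Arguments.
Unset Strict Implicit.
Unset Printing Implicit Defensive.

(* Time is cut into phases. In phase [m] put [N = 2 ^ m.+1] and               *)
(* [d = 1 / N ^ 2]; the player sits at a level between 0 and [N]. Every tick  *)
(* of the clock has a level [y]: it sends everybody above [y] down to [y],    *)
(* and a player at level [y < N] may then skip or try to climb, which         *)
(* succeeds with probability [d], is fatal with probability [d ^ 2] and       *)
(* otherwise changes nothing. At level [N] the goal is visited. The ticks of  *)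
(* the levels above [y] are nested between consecutive ticks of level [y].    *)
(*                                                                            *)
(* A player who remembers whether the goal was visited in the current phase   *)
(* tries until it is and then skips. This takes about [N] climbs, each with a *)
(* relative risk [d], so that the phase fails with probability at most        *)
(* [2 ^- m]; skipping the first phases makes the total failure small.         *)
(*                                                                            *)
(* The choices of a Markov player at a tick are the same before and after the *)
(* visit. Let [s] and [l] be the probabilities that such a player at level    *)
(* [y] visits the goal, respectively is lost, before the next tick below [y]. *)
(* Then [l >= b_y * (s + s ^+ 2 / 4)] with [b_y = ((N - y) / N) ^+ 2 / 16]:   *)
(* the quadratic term is gained because successes are wasted after the first  *)
(* one while their risks add up, and by AM-GM this gain and the risk [d] of   *)
(* one climb let the square root of [b_y] grow by about [sqrt d / 4] when [y] *)
(* decreases by one. Hence at level 0 a visit is at most 16 times as likely   *)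
(* as a loss. As the total probability of loss is at most 1, the probability  *)
(* to visit the goal after phase [m] tends to 0 with [m].                     *)

(** * Finite distributions and finite-horizon expectations *)

(** The construction and its heuristics are given above; the proof turns them into estimates over
    finite paths. Successors are listed explicitly, so an expectation at a fixed horizon is a finite
    sum, and every bound states that some potential is a sub- or supermartingale
    ([expect_submartingale], [expect_supermartingale]). [run_law_prefix] carries these bounds over
    to the law of the runs.

    For a Markov strategy the probability to try depends on the tick alone ([markov_tryE]).
    Therefore both the survival probability and a lower bound for the probability of no visit factor
    over the levels, with the factors [local_val]. The two kinds of factors are compared by
    [local_ratio], whose inductive step is [loss_bound_climb] and [rate_climb]. [markov_visit_bound]
    then bounds the probability of a visit between two ticks by 16 times the drop of the survival
    probability. These drops become arbitrarily small, which gives [markov_buchi].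

    For the strategy with memory, [hit_word] bounds the success of one phase and [phase_success]
    turns this into a bound under the strategy. The failures sum to a geometric series, so
    [memory_visit_bound] is uniform in the phase and survives the passage to the limit in
    [memory_buchi]. Finally [limsup_ge0_buchi] identifies the two events. *)

Section finite_distr.
Context (R : realType) (T : choiceType).
Local Open Scope ring_scope.
Implicit Types (l : seq (R * T)) (f : T -> R).

Definition list_mass l (t : T) : R := \sum_(i <- l) i.1 * (t == i.2)%:R.

Lemma list_mass_ge0 l t : all (fun i => 0 <= i.1) l -> 0 <= list_mass l t.
Proof.
move=> /allP l0; rewrite /list_mass big_seq; apply: sumr_ge0 => i il.
by rewrite mulr_ge0// l0.
Qed.

Lemma list_mass_total l : all (fun i => 0 <= i.1) l ->
  (\esum_(t in [set: T]) (list_mass l t)%:E = (\sum_(i <- l) i.1)%:E)%E.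
Proof.
elim: l => [_|[w u] l IH /= /andP[w0 l0]].
  by rewrite big_nil esum1// => t _; rewrite /list_mass big_nil.
rewrite big_cons EFinD -IH//.
under eq_esum do rewrite /list_mass big_cons EFinD.
rewrite esumD//; last 2 first.
- by move=> t _; rewrite lee_fin mulr_ge0.
- by move=> t _; rewrite lee_fin list_mass_ge0.
congr (_ + _)%E; rewrite -[RHS](@esum_set1 _ _ u (fun=> w%:E))//.
rewrite [RHS]esum_mkcond; apply: eq_esum => t _ /=; case: eqVneq => [->|tu].
  by rewrite mulr1 mem_set.
by rewrite mulr0 memNset//; exact/eqP.
Qed.

Lemma list_distr_subproof l : all (fun i => 0 <= i.1) l ->
  \sum_(i <- l) i.1 = 1 -> (\esum_(t in [set: T]) (list_mass l t)%:E = 1)%E.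
Proof. by move=> l0 l1; rewrite list_mass_total// l1. Qed.

Definition list_distr l (l0 : all (fun i => 0 <= i.1) l)
    (l1 : \sum_(i <- l) i.1 = 1) : distr R T :=
  Distr (fun t => @list_mass_ge0 l t l0) (list_distr_subproof l0 l1).

Lemma list_mass_supp l t : list_mass l t != 0 -> t \in [seq i.2 | i <- l].
Proof.
apply: contraNT => tl; rewrite /list_mass big_seq big1// => i il.
by case: eqP => [ti|]; [rewrite ti map_f in tl|rewrite mulr0].
Qed.

Lemma sum_list_mass l (r : seq T) f : uniq r ->
  {subset [seq i.2 | i <- l] <= r} ->
  \sum_(t <- r) list_mass l t * f t = \sum_(i <- l) i.1 * f i.2.
Proof.
move=> ur lr; rewrite /list_mass; under eq_bigr do rewrite mulr_suml.
rewrite exchange_big/= big_seq [RHS]big_seq; apply: eq_bigr => i il.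
rewrite (bigD1_seq i.2)/= ?lr ?map_f// eqxx mulr1 big1 ?addr0// => t ti.
by rewrite (negbTE ti) mulr0 mul0r.
Qed.

Definition dirac_distr (t : T) : distr R T.
Proof. by apply: (@list_distr [:: (1, t)]); rewrite /= ?ler01// big_seq1. Defined.

Lemma dirac_distrE t u : dirac_distr t u = (u == t)%:R.
Proof. by rewrite /= /list_mass big_seq1/= mul1r. Qed.

Lemma distr_total (d : distr R T) (r : seq T) : uniq r ->
  (forall t, d t != 0 -> t \in r) -> \sum_(t <- r) d t = 1.
Proof.
move=> ur dr; apply: EFin_inj; rewrite -(mass_total d) -sumEFin fsbig_seq//.
rewrite -esum_fset//=; last by move=> t _; rewrite lee_fin mass_ge0.
rewrite [LHS]esum_mkcond; apply: eq_esum => t _; case: ifPn => // tr.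
congr EFin; apply/esym/eqP; apply: contraNT tr => /dr tr.
by rewrite mem_set.
Qed.

Lemma distr_le1 (d : distr R T) t : d t <= 1.
Proof.
rewrite -lee_fin -(mass_total d); apply: esum_ge; exists [set t].
  by split; [exact: finite_set1|].
by rewrite fsbig_set1.
Qed.

End finite_distr.

(** * Expectations over paths of a fixed length *)

Section finite_horizon.
Context (R : realType) (M : mdp R) (s0 : M) (succ : M -> seq M).
Hypothesis succ_uniq : forall s, uniq (succ s).
Hypothesis succE : forall s t, trans s t = (t \in succ s).
Context (sigma : strategy M).
Local Open Scope ring_scope.
Implicit Types (p : seq M) (f g : seq M -> R) (Q : pred (seq M)) (n : nat).

Local Notation k := (next_state sigma s0).

Fixpoint paths n : seq (seq M) :=
  if n is n'.+1 then [seq rcons p t | p <- paths n', t <- succ (last s0 p)]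
  else [:: [::]].

Definition weight p : R := \prod_(i < size p) k (take i p) (nth s0 p i).

Definition expect n f : R := \sum_(p <- paths n) weight p * f p.

Lemma mem_paths n p : (p \in paths n) = path (@trans R M) s0 p && (size p == n).
Proof.
elim: n p => [|n IH] p /=; first by rewrite inE; case: p => //= t p; rewrite andbF.
apply/allpairsPdep/idP => [[q [t [+ + ->]]]|].
  rewrite IH -succE => /andP[q0 /eqP <-] qt.
  by rewrite rcons_path q0 qt size_rcons eqxx.
case/lastP: p => [|p t]; first by rewrite andbF.
rewrite rcons_path size_rcons eqSS -andbA andbCA => /andP[pt p0].
by exists p, t; rewrite IH p0 -succE pt.
Qed.

Lemma paths_uniq n : uniq (paths n).
Proof.
elim: n => // n IH /=; apply: allpairs_uniq_dep => //.
by move=> [p t] [q u] _ _ /= /rcons_inj[-> ->].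
Qed.

Lemma next_state_supp p t : path (@trans R M) s0 p -> k p t != 0 ->
  t \in succ (last s0 p).
Proof.
move=> pp; rewrite -succE /next_state; case: ifPn => [pc|]; last exact: prob_succ.
by apply: choice_succ; rewrite /history pp.
Qed.

Lemma next_state_total p : path (@trans R M) s0 p ->
  \sum_(t <- succ (last s0 p)) k p t = 1.
Proof. by move=> pp; apply: distr_total => // t; exact: next_state_supp. Qed.

Lemma weight_ge0 p : 0 <= weight p.
Proof. by apply: prodr_ge0 => i _; exact: mass_ge0. Qed.

Lemma weight_rcons p t : weight (rcons p t) = weight p * k p t.
Proof.
rewrite /weight size_rcons big_ord_recr/= nth_rcons ltnn eqxx.
rewrite -cats1 take_size_cat//; congr (_ * _); apply: eq_bigr => i _.
by rewrite takel_cat ?(ltnW (ltn_ord i))// nth_cat ltn_ord.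
Qed.

Lemma expect0 f : expect 0 f = f [::].
Proof. by rewrite /expect big_seq1 /weight big_ord0 mul1r. Qed.

Lemma expectS n f : expect n.+1 f =
  expect n (fun p => \sum_(t <- succ (last s0 p)) k p t * f (rcons p t)).
Proof.
rewrite /expect /= big_allpairs_dep; apply: eq_bigr => p _.
rewrite mulr_sumr; apply: eq_bigr => t _.
by rewrite weight_rcons mulrA.
Qed.

Lemma expect_le n f g :
  (forall p, path (@trans R M) s0 p -> size p = n -> f p <= g p) ->
  expect n f <= expect n g.
Proof.
move=> fg; rewrite /expect big_seq [leRHS]big_seq; apply: ler_sum => p.
by rewrite mem_paths => /andP[pp /eqP pn]; rewrite ler_wpM2l ?weight_ge0 ?fg.
Qed.

Lemma expect_cst n (c : R) : expect n (fun=> c) = c.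
Proof.
elim: n => [|n IH]; first by rewrite expect0.
rewrite expectS -[RHS]IH /expect big_seq [RHS]big_seq; apply: eq_bigr => p.
rewrite mem_paths => /andP[pp _].
by rewrite -mulr_suml next_state_total// mul1r.
Qed.

Lemma expectD n f g : expect n (f \+ g) = expect n f + expect n g.
Proof. by rewrite /expect -big_split; apply: eq_bigr => p _; rewrite /= mulrDr. Qed.

Lemma expectZ n (c : R) f : expect n (fun p => c * f p) = c * expect n f.
Proof. by rewrite /expect mulr_sumr; apply: eq_bigr => p _; rewrite mulrCA. Qed.

Lemma expect_submartingale f a b : (a <= b)%N ->
  (forall p, path (@trans R M) s0 p -> (a <= size p < b)%N ->
    f p <= \sum_(t <- succ (last s0 p)) k p t * f (rcons p t)) ->
  expect a f <= expect b f.
Proof.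
move=> ab fk; elim: b ab fk => [|b IH].
  by rewrite leqn0 => /eqP ->.
rewrite leq_eqVlt => /predU1P[->//|]; rewrite ltnS => ab fk.
apply: le_trans (IH ab _) _ => [p pp /andP[ap pb]|].
  by apply: fk; rewrite // ap leqW.
by rewrite expectS; apply: expect_le => p pp pb; apply: fk; rewrite // pb ab ltnSn.
Qed.

Lemma expect_supermartingale f a b : (a <= b)%N ->
  (forall p, path (@trans R M) s0 p -> (a <= size p < b)%N ->
    \sum_(t <- succ (last s0 p)) k p t * f (rcons p t) <= f p) ->
  expect b f <= expect a f.
Proof.
move=> ab fk; have := @expect_submartingale (fun p => -1 * f p) a b ab.
rewrite !expectZ !mulN1r lerN2; apply => p pp pab.
rewrite (le_trans _ (_ : - \sum_(t <- succ (last s0 p)) k p t * f (rcons p t) <= _))//.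
  by rewrite mulN1r lerN2 fk.
by rewrite -sumrN; apply: ler_sum => t _; rewrite mulN1r mulrN.
Qed.

Definition run_prefix n (rho : runs s0) : seq M := mkseq (fun i => rho i.+1) n.

Lemma measurable_determined n (A : set (runs s0)) :
  (forall x y : nat -> M, (forall i, (i < n)%N -> x i = y i) -> A x -> A y) ->
  measurable A.
Proof. by move=> An; apply: sub_sigma_algebra; exists n. Qed.

Lemma measurable_prefix n Q : measurable [set rho | Q (run_prefix n rho)].
Proof.
apply: (@measurable_determined n.+1) => x y xy /=.
suff -> : run_prefix n x = run_prefix n y by [].
by apply/eq_in_map => i; rewrite mem_iota => /= ni; apply: xy.
Qed.

(** The paths satisfying [Q] form a finite disjoint union of cylinders, which gives a lower bound
    for the measure. The same bound for the negation of [Q] gives equality, because the two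
    expectations sum to 1; sequences that are not paths need no separate treatment. *)
Lemma run_law_prefix n Q :
  run_law s0 sigma [set rho | Q (run_prefix n rho)] =
  (expect n (fun p => (Q p)%:R))%:E.
Proof.
set P := run_law s0 sigma.
pose cyl p : set (runs s0) :=
  [set rho | forall i, (i <= size p)%N -> rho i = nth s0 (s0 :: p) i].
have mcyl p : measurable (cyl p).
  by apply: (@measurable_determined (size p).+1) => x y xy xp i ip; rewrite -xy ?xp.
have cyl_prefix p rho : cyl p rho -> run_prefix (size p) rho = p.
  move=> rp; apply: (@eq_from_nth _ s0); rewrite ?size_mkseq// => i ip.
  by rewrite nth_mkseq// rp.
have union l : uniq l -> {in l, forall p, size p = n} ->
    measurable [set rho | exists2 p, p \in l & cyl p rho] /\
    P [set rho | exists2 p, p \in l & cyl p rho] = (\sum_(p <- l) weight p)%:E.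
  elim: l => [_ _|p l IH /= /andP[pl ul] ln].
    have -> : [set rho | exists2 p : seq M, p \in [::] & cyl p rho] = set0.
      by apply/seteqP; split => // rho [].
    by rewrite big_nil measure0.
  have [|ml Pl] := IH ul; first by move=> q ql; rewrite ln// inE ql orbT.
  have -> : [set rho | exists2 q, q \in p :: l & cyl q rho] =
      cyl p `|` [set rho | exists2 p, p \in l & cyl p rho].
    apply/seteqP; split=> rho.
      by move=> [q]; rewrite inE => /predU1P[-> ?|ql ?]; [left|right; exists q].
    by move=> [?|[q ql ?]]; [exists p|exists q]; rewrite ?inE ?eqxx ?ql ?orbT.
  split; first exact: measurableU.
  rewrite measureU//.
    by rewrite big_cons EFinD -Pl; congr (_ + _)%E; exact: run_lawP.
  apply/seteqP; split=> // rho [/cyl_prefix rp [q ql /cyl_prefix rq]].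
  move: rp rq; rewrite !ln ?inE ?eqxx ?ql ?orbT// => -> pq.
  by rewrite pq ql in pl.
have lower Q' : ((expect n (fun p => (Q' p)%:R))%:E <=
    P [set rho | Q' (run_prefix n rho)])%E.
  have [||ml] := union [seq p <- paths n | Q' p].
  - by rewrite filter_uniq// paths_uniq.
  - by move=> p; rewrite mem_filter mem_paths => /and3P[_ _ /eqP].
  rewrite big_filter (_ : \sum_(p <- _ | _) _ = expect n (fun p => (Q' p)%:R)).
    move=> <-; apply: le_measure; rewrite ?inE//; first exact: measurable_prefix.
    move=> rho [p]; rewrite mem_filter mem_paths => /and3P[Qp _ /eqP pn].
    by move=> /cyl_prefix; rewrite pn /= => ->.
  by rewrite /expect big_mkcond; apply: eq_bigr => p _; case: (Q' p);
    rewrite ?mulr1 ?mulr0.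
apply/eqP; rewrite eq_le lower andbT.
have := lower (predC Q).
have -> : [set rho | predC Q (run_prefix n rho)] = ~` [set rho | Q (run_prefix n rho)].
  by apply/seteqP; split=> rho /= /negP.
rewrite probability_setC; last exact: measurable_prefix.
have fin : P [set rho | Q (run_prefix n rho)] \is a fin_num.
  by apply: fin_num_measure; exact: measurable_prefix.
rewrite -(fineK fin) -EFinB !lee_fin.
have : expect n (fun p => (Q p)%:R) + expect n (fun p => (predC Q p)%:R) = 1.
  rewrite -expectD -[RHS](expect_cst n 1) /expect; apply: eq_bigr => p _ /=.
  by case: (Q p); rewrite ?addr0 ?add0r.
lra.
Qed.

End finite_horizon.

(** * The decision process *)

Fixpoint lane (N K j : nat) : seq nat :=
  if j is j'.+1 then flatten (nseq K ((N - j)%N :: lane N K j')) else [:: N].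

Definition width (m : nat) : nat := (2 ^ m.+1)%N.

(** The number of repetitions is the inverse square of the chance to climb, so that a player who
    always tries gets stuck at a level with probability at most that chance ([expr_chance_le]). *)
Definition word (m : nat) : seq nat := lane (width m) (width m ^ 4) (width m).

Definition schedule (M : nat) : seq (nat * nat) :=
  flatten [seq [seq (m, y) | y <- word m] | m <- iota 0 M].

Definition start (m : nat) : nat := size (schedule m).

(** No word is empty, so [schedule t.+1] has more than [t] entries and the default pair is never
    returned. *)
Definition tick (t : nat) : nat * nat := nth (0, 0)%N (schedule t.+1) t.

Section schedule_theory.
Local Open Scope nat_scope.

Lemma width_gt1 m : 1 < width m.
Proof. by rewrite /width expnS leq_pmulr// expn_gt0. Qed.

Lemma lane_bounds N K j y : j <= N -> y \in lane N K j -> N - j <= y <= N.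
Proof.
elim: j => [_|j IH jN]; first by rewrite inE => /eqP ->; rewrite subn0 leqnn.
move=> /flattenP[s /nseqP[-> _]]; rewrite inE => /predU1P[->|/(IH (ltnW jN))].
  by rewrite leqnn leq_subr.
by move=> /andP[jy ->]; rewrite andbT; apply: leq_trans jy; rewrite leq_sub2l.
Qed.

Lemma word_le m y : y \in word m -> y <= width m.
Proof. by move=> /lane_bounds => /(_ (leqnn _))/andP[]. Qed.

Lemma word_cons m : exists w, word m = 0 :: w.
Proof.
have := width_gt1 m; rewrite /word; case: (width m) => // N _.
have : 0 < N.+1 ^ 4 by rewrite expn_gt0.
by case: (N.+1 ^ 4) => //= K _; rewrite subnn; eexists.
Qed.

Lemma word_size_gt0 m : 0 < size (word m).
Proof. by have [w ->] := word_cons m. Qed.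

Lemma word_nth0 m : nth 0 (word m) 0 = 0.
Proof. by have [w ->] := word_cons m. Qed.

Lemma scheduleS M : schedule M.+1 = schedule M ++ [seq (M, y) | y <- word M].
Proof. by rewrite /schedule -addn1 iotaD map_cat flatten_cat/= cats0. Qed.

Lemma startS m : start m.+1 = start m + size (word m).
Proof. by rewrite /start scheduleS size_cat size_map. Qed.

Lemma leq_start m : m <= start m.
Proof.
by elim: m => // m IH; rewrite startS -addn1 leq_add// word_size_gt0.
Qed.

Lemma start_mono m n : m <= n -> start m <= start n.
Proof.
by move=> /subnKC <-; elim: (n - m) => [|d IH]; rewrite ?addn0// addnS startS
  (leq_trans IH)// leq_addr.
Qed.

Lemma nth_schedule M M' t : M <= M' -> t < start M ->
  nth (0, 0) (schedule M') t = nth (0, 0) (schedule M) t.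
Proof.
move=> /subnKC <-; elim: (M' - M) => [|d IH] tM; first by rewrite addn0.
rewrite addnS scheduleS nth_cat IH// ifT//.
by apply: leq_trans tM _; apply: start_mono; rewrite leq_addr.
Qed.

Lemma tick_start m i : i < size (word m) ->
  tick (start m + i) = (m, nth 0 (word m) i).
Proof.
move=> im; have im' : start m + i < start m.+1 by rewrite startS ltn_add2l.
rewrite /tick -(@nth_schedule _ (maxn m.+1 (start m + i).+1)) ?leq_maxr//; last first.
  by apply: leq_trans (leq_start _).
rewrite (@nth_schedule m.+1) ?leq_maxl// scheduleS nth_cat.
by rewrite -/(start m) ltnNge leq_addr/= addKn (nth_map 0).
Qed.

Lemma tick_start0 m : tick (start m) = (m, 0).
Proof. by rewrite -[start m]addn0 tick_start ?word_nth0// word_size_gt0. Qed.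

Lemma phaseP t : exists m i, i < size (word m) /\ t = start m + i.
Proof.
elim: t => [|t [m [i [im ->]]]].
  by exists 0, 0; rewrite word_size_gt0 addn0.
case: (ltnP i.+1 (size (word m))) => [im'|mi]; first by exists m, i.+1; rewrite addnS.
exists m.+1, 0; rewrite word_size_gt0 addn0 startS; split=> //.
by rewrite -addnS; congr addn; apply/eqP; rewrite eqn_leq im mi.
Qed.

Lemma tick_le t : (tick t).2 <= width (tick t).1.
Proof.
have [m [i [im ->]]] := phaseP t.
by rewrite tick_start//=; apply: word_le; exact: mem_nth.
Qed.

Lemma tickS t : (tick t.+1).1 = (tick t).1 \/ (tick t.+1).2 = 0.
Proof.
have [m [i [im ->]]] := phaseP t; rewrite (tick_start im)/= -addnS.
case: (ltnP i.+1 (size (word m))) => [im'|mi]; first by left; rewrite tick_start.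
right; rewrite (_ : i.+1 = size (word m)) -?startS ?tick_start0//.
by apply/eqP; rewrite eqn_leq im mi.
Qed.

End schedule_theory.

(** * States, moves and rewards of the example *)

Section example.
Context (R : realType).
Local Open Scope ring_scope.

Definition chance (m : nat) : R := ((width m)%:R ^+ 2)^-1.

(* [(k, None)] is the lost player after [k] steps, [(k, Some None)] a player  *)
(* whose attempt to climb is pending, and [(k, Some (Some x))] a player at    *)
(* level [x]. Tick [t] takes place at step [2 t]; an attempt made at step     *)
(* [2 t] is decided when leaving step [2 t + 1].                              *)
Definition place := (nat * option (option nat))%type.

(** The cut to the level of a tick happens on arrival at the even step, so that nobody stands above
    the tick when the choice is made. *)
Definition landing (k x : nat) : place :=
  (k, Some (Some (if odd k then x else minn x (tick k./2).2))).

Definition offered : pred place := fun s =>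
  if s is (k, Some (Some x)) then
    [&& ~~ odd k, x == (tick k./2).2 & (x < width (tick k./2).1)%N]
  else false.

Definition goal : pred place := fun s =>
  if s is (k, Some (Some x)) then
    [&& ~~ odd k, x == (tick k./2).2 & x == width (tick k./2).1]
  else false.

Definition moves (s : place) : seq (R * place) :=
  match s with
  | (k, None) => [:: (1, (k.+1, None))]
  | (k, Some None) =>
    let: (m, y) := tick k./2 in
    [:: (chance m ^+ 2, (k.+1, None)); (chance m, landing k.+1 y.+1);
        (1 - chance m - chance m ^+ 2, landing k.+1 y)]
  | (k, Some (Some x)) => [:: (1, landing k.+1 x)]
  end.

(** At an offered state the support of [moves] is the option to skip; the attempt is the successor
    added here. *)
Definition succs (s : place) : seq place :=
  undup ([seq i.2 | i <- moves s]
    ++ if offered s then [:: (s.1.+1, Some None)] else [::]).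

Lemma chance_gt0 m : 0 < chance m.
Proof. by rewrite invr_gt0 exprn_gt0// ltr0n (ltn_trans _ (width_gt1 m)). Qed.

Lemma chance_le m : chance m <= 4^-1.
Proof.
rewrite lef_pV2 ?posrE// ?exprn_gt0 ?ltr0n//; last exact: ltnW (width_gt1 m).
have : 2 <= (width m)%:R :> R by rewrite (ler_nat _ 2) width_gt1.
nra.
Qed.

Lemma moves_ge0 s : all (fun i => 0 <= i.1) (moves s).
Proof.
case: s => k [[x|]|] /=; rewrite ?ler01//.
case: (tick _) => m y /=; have := chance_gt0 m; have := chance_le m.
by move=> ? ?; rewrite !andbT; apply/and3P; split; nra.
Qed.

Lemma moves_total s : \sum_(i <- moves s) i.1 = 1.
Proof.
case: s => k [[x|]|] /=; rewrite ?big_seq1//.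
by case: (tick _) => m y; rewrite !big_cons big_nil/=; ring.
Qed.

Definition move_distr s : distr R place := list_distr (moves_ge0 s) (moves_total s).

Lemma succs_nonempty (s : place) : exists t, t \in succs s.
Proof.
suff [t st] : exists t, t \in [seq i.2 | i <- moves s].
  by exists t; rewrite mem_undup mem_cat st.
case: s => k [[x|]|] /=; try by eexists; exact: mem_head.
by case: (tick _) => m y; eexists; exact: mem_head.
Qed.

Lemma move_succs (s t : place) : s \notin offered -> move_distr s t != 0 ->
  t \in succs s.
Proof. by move=> _ /list_mass_supp st; rewrite mem_undup mem_cat st. Qed.

Definition example : mdp R :=
  @MDP R place offered (fun s t => t \in succs s) move_distr
    (fun s _ => if goal s then 1 else -1) succs_nonempty move_succs.

Definition origin : example := (0%N, Some (Some 0%N)).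

Lemma succs_uniq s : uniq (succs s).
Proof. exact: undup_uniq. Qed.

Lemma succs_step (s t : place) : t \in succs s -> t.1 = s.1.+1.
Proof.
rewrite mem_undup mem_cat => /orP[]; last by case: ifP => //; rewrite inE => _ /eqP ->.
case: s => k [[x|]|] /=; rewrite ?inE; try by move=> /eqP ->.
by case: (tick _) => m y; rewrite !inE => /or3P[] /eqP ->.
Qed.

Lemma path_step (s : place) (p : seq place) :
  path (fun s t => t \in succs s) s p -> (last s p).1 = (s.1 + size p)%N.
Proof.
elim: p s => [|t p IH] s /=; first by rewrite addn0.
by move=> /andP[/succs_step st /IH ->]; rewrite st addSnnS.
Qed.

Lemma example_step_counter : step_counter_implicit origin.
Proof. by move=> p q /path_step pp /path_step qq pq; move: pp; rewrite pq qq !add0n. Qed.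

Lemma example_finitely_branching : finitely_branching example.
Proof. by move=> s; exact: finite_seq. Qed.

End example.

(** * Markov strategies *)

Section ratio.
Context (R : realType).
Local Open Scope ring_scope.
Implicit Types (b d l s u : R).

Definition loss_bound b s : R := b * (s + s ^+ 2 / 4).

(** Trying with probability [q] mixes the two pure choices, and the bound is convex in [s]: the
    defect is a nonnegative multiple of [(s - s') ^+ 2]. *)
Lemma loss_bound_convex b q s s' l l' : 0 <= b -> 0 <= q <= 1 ->
  loss_bound b s <= l -> loss_bound b s' <= l' ->
  loss_bound b ((1 - q) * s + q * s') <= (1 - q) * l + q * l'.
Proof.
move=> b0 /andP[q0 q1] sl sl'.
apply: (@le_trans _ _ ((1 - q) * loss_bound b s + q * loss_bound b s')); last first.
  by rewrite lerD// ler_wpM2l// subr_ge0.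
rewrite -subr_ge0 /loss_bound.
rewrite (_ : _ - _ = b * ((1 - q) * q * (s - s') ^+ 2 / 4)); last by field.
by rewrite mulr_ge0// divr_ge0// mulr_ge0 ?sqr_ge0// mulr_ge0// subr_ge0.
Qed.

(** Here [s] and [l] belong to the later play at the same level, [s'] and [l'] to the excursion one
    level up. The new success counts only with factor [1 - s], while its risk [d * (d + l')] is
    discounted merely by [1 - h] with [h <= s / 8]. This difference pays for the linear growth of
    the quadratic term, and the factor [1 + d] pays for the rest of that term, which is still there
    when [s] is near 0. *)
Lemma loss_bound_climb b d l l' s s' : 0 <= b <= 16^-1 -> 0 <= d <= 4^-1 ->
  0 <= l <= 1 -> 0 <= l' <= 1 -> 0 <= s <= 1 -> 0 <= s' <= 1 ->
  loss_bound b s <= l -> b * (1 + d) * s' <= d + l' ->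
  loss_bound b (1 - (1 - s) * (1 - d * s')) <=
    1 - (1 - l) * (1 - d * (d + l')).
Proof.
rewrite /loss_bound => /andP[b0 b1] /andP[d0 d1] /andP[l0 l1] /andP[l'0 l'1].
move=> /andP[s0 s1] /andP[s'0 s'1] sl s'l.
set e := d * s'; have e0 : 0 <= e by rewrite mulr_ge0.
have ed : e <= d by rewrite ler_piMr.
have er : b * (1 + d) * e <= d * (d + l').
  by rewrite /e mulrCA ler_wpM2l.
have dl1 : d * (d + l') <= 1 by nra.
set r := d * (d + l') in er dl1 *; clearbody r e.
set h := b * (s + s ^+ 2 / 4) in sl.
have h_s : h <= s / 8.
  have : h <= b * (s + s / 4).
    by rewrite /h ler_wpM2l// lerD2l ler_wpM2r// expr2 ler_piMr.
  have : b * (s + s / 4) <= 16^-1 * (s + s / 4) by rewrite ler_wpM2r//; lra.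
  lra.
have step1 : 1 - (1 - l) * (1 - r) >= 1 - (1 - h) * (1 - r) by nra.
have step2 : 1 - (1 - h) * (1 - r) >= h + (1 - h) * (b * (1 + d) * e).
  have : (1 - h) * (b * (1 + d) * e) <= (1 - h) * r by rewrite ler_wpM2l//; lra.
  lra.
apply: le_trans (le_trans step2 step1).
rewrite -subr_ge0.
rewrite (_ : _ - _ = b * e * ((1 - h) * (1 + d) - (1 - s) - s * (1 - s) / 2
  - (1 - s) ^+ 2 * e / 4)); last by rewrite /h; field.
rewrite mulr_ge0// ?mulr_ge0//.
have : (1 - s / 8) * (1 + d) <= (1 - h) * (1 + d) by rewrite ler_wpM2r//; lra.
have : (1 - s) ^+ 2 * e <= 1 * d.
  by rewrite ler_pM// ?sqr_ge0// expr_le1//; lra.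
nra.
Qed.

Definition rate (m z : nat) : R := ((width m - z)%:R ^+ 2) * chance R m / 16.

Lemma width_chance m : (width m)%:R ^+ 2 * chance R m = 1.
Proof.
by rewrite divff// expf_neq0// pnatr_eq0 -lt0n (ltn_trans _ (width_gt1 m)).
Qed.

Lemma rate_ge0 m z : 0 <= rate m z.
Proof. by rewrite divr_ge0// mulr_ge0// ?sqr_ge0// ltW// chance_gt0. Qed.

Lemma rate0 m : rate m 0 = 16^-1.
Proof. by rewrite /rate subn0 width_chance mul1r. Qed.

Lemma rate_le m z : rate m z <= 16^-1.
Proof.
rewrite -(rate0 m) /rate ler_wpM2r// ler_wpM2r ?(ltW (chance_gt0 _ _))//.
by rewrite ler_pXn2r// ?nnegrE// ler_nat subn0 leq_subr.
Qed.

Lemma rate_width m : rate m (width m) = 0.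
Proof. by rewrite /rate subnn expr0n/= !mul0r. Qed.

(** Let [i = width m - z - 1]. Up to the factor [d / 16], passing from [i ^+ 2] to [(i + 1) ^+ 2]
    costs [2 * i * s + s], and the factor [1 + d] costs at most [s] because [(i + 1) ^+ 2 * d <= 1].
    The available gain is [16 + i ^+ 2 * s ^+ 2 / 4], which equals [2 * i * s + 12] plus the square
    of [i * s / 2 - 2]. *)
Lemma rate_climb m z l s : (z < width m)%N -> 0 <= s <= 1 ->
  loss_bound (rate m z.+1) s <= l ->
  rate m z * (1 + chance R m) * s <= chance R m + l.
Proof.
move=> zm /andP[s0 s1]; rewrite /loss_bound /rate subnS => sl.
have [i iE] : exists i, (width m - z = i.+1)%N.
  by exists (width m - z).-1; rewrite prednK// subn_gt0.
rewrite iE/= in sl *; have i1 : (i%:R + 1) ^+ 2 * chance R m <= 1.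
  rewrite -[leRHS](width_chance m) ler_wpM2r ?(ltW (chance_gt0 _ _))//.
  by rewrite natr1 -iE ler_pXn2r// ?nnegrE// ler_nat leq_subr.
have i0 : 0 <= i%:R :> R by [].
rewrite -natr1; move: i1 sl i0 (chance_gt0 R m); move: (i%:R) (chance R m) => {iE}i d.
move=> i1 sl i0 d0.
apply: le_trans (_ : d + i ^+ 2 * d / 16 * (s + s ^+ 2 / 4) <= _); last by rewrite lerD2l.
have : (i + 1) ^+ 2 * d * (d / 16) * s <= 1 * (d / 16) * s.
  by rewrite ler_wpM2r// ler_wpM2r// ltW// divr_gt0.
have : 0 <= d / 16 * ((i * s / 2 - 2) ^+ 2 + 12 - 2 * s).
  by rewrite mulr_ge0// ?ltW ?divr_gt0//; have := sqr_ge0 (i * s / 2 - 2); lra.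
move=> h1 h2.
rewrite -subr_ge0.
rewrite (_ : _ - _ = d / 16 * ((i * s / 2 - 2) ^+ 2 + 12 - 2 * s) +
  (1 * (d / 16) * s - (i + 1) ^+ 2 * d * (d / 16) * s)); last by field.
by rewrite addr_ge0// subr_ge0.
Qed.

End ratio.

(** * Loss against success at one level *)

Section local_survival.
Local Open Scope ring_scope.
Context (R : realType) (q : nat -> R).
Hypothesis q01 : forall t, 0 <= q t <= 1.

(* For a player at level [z] before tick [t] who tries at tick [i] with       *)
(* probability [q i], until the next tick below [z] but for at most [d]       *)
(* ticks: the probability not to be lost if [kappa] holds, and otherwise a    *)
(* lower bound for the probability not to visit the goal, in which lost       *)
(* players carry on.                                                          *)
Fixpoint local_val (kappa : bool) (d t z : nat) : R :=
  if d is d'.+1 then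
    let: (m, y) := tick t in
    let v := local_val kappa d' t.+1 in
    if (y < z)%N then 1
    else if (z < y)%N then v z
    else if y == width m then kappa%:R
    else (1 - q t) * v z + q t * (v z * (1 - chance R m
      - kappa%:R * chance R m ^+ 2 + chance R m * v z.+1))
  else 1.

Lemma local_val01 kappa d t z : 0 <= local_val kappa d t z <= 1.
Proof.
have : 0 <= (kappa%:R : R) <= 1 by rewrite ler0n (ler_nat _ _ 1) leq_b1.
move=> k01; elim: d t z => [|d IH] t z /=; first by rewrite ler01 lexx.
case: (tick t) => m y; case: ifP => _; first by rewrite ler01 lexx.
case: ifP => _; first exact: IH.
case: ifP => _; first exact: k01.
have /andP[q0 q1] := q01 t; have /andP[] := IH t.+1 z; have /andP[] := IH t.+1 z.+1.
move: (local_val _ _ _ z) (local_val _ _ _ z.+1) => v v' v'0 v'1 v0 v1.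
have := chance_gt0 R m; have := chance_le R m; move: (chance R m) => c c1 c0.
move: k01; move: (kappa%:R) => k /andP[k0 k1].
have w01 : 0 <= 1 - c - k * c ^+ 2 + c * v' <= 1.
  have c20 : 0 <= c ^+ 2 by rewrite sqr_ge0.
  have : 0 <= k * c ^+ 2 by rewrite mulr_ge0.
  have : k * c ^+ 2 <= 1 * c by rewrite ler_pM//; nra.
  by move=> ? ?; apply/andP; split; nra.
move: w01 => /andP[]; set w := _ + _ => w0 w1.
have vw0 : 0 <= v * w by rewrite mulr_ge0.
have vw1 : v * w <= 1 by rewrite mulr_ile1.
by clearbody w; apply/andP; split; nra.
Qed.

(** Induction on the number of ticks. The disjunction lets the induction cross the end of a phase:
    the next phase opens with a tick of level 0, where the claim is trivial for positive [z], and
    for [z = 0] the rate is [16^-1] in every phase. *)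
Lemma local_ratio d t m z : m = (tick t).1 \/ (tick t).2 = 0%N ->
  loss_bound (rate R m z) (1 - local_val false d t z) <= 1 - local_val true d t z.
Proof.
have triv b : loss_bound b (1 - 1 : R) <= 1 - 1 :> R.
  by rewrite /loss_bound subrr expr0n/= mul0r addr0 mulr0.
elim: d t m z => [|d IH] t m z /=; first by move=> _; exact: triv.
have := tick_le t; have := tickS t; case: (tick t) => n y /= tS yn mt.
have nS : n = (tick t.+1).1 \/ (tick t.+1).2 = 0%N by case: tS => ->; [left|right].
case: ifPn => [_|]; first exact: triv.
rewrite -leqNgt => zy; case: ifPn => [zy'|].
  case: mt => [->|y0]; first exact: IH.
  by rewrite y0 in zy'.
rewrite -leqNgt => yz; have {yz zy}-> : z = y by apply/eqP; rewrite eqn_leq zy yz.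
have {mt}-> : rate R m y = rate R n y by case: mt => [->//|->]; rewrite !rate0.
case: eqVneq => [->|yn']; first by rewrite rate_width /loss_bound mul0r/= subrr.
have {yn' yn}yn : (y < width n)%N by rewrite ltn_neqAle yn' yn.
have := local_val01 false d t.+1 y; have := local_val01 false d t.+1 y.+1.
have := local_val01 true d t.+1 y; have := local_val01 true d t.+1 y.+1.
have := IH t.+1 n y nS; have := IH t.+1 n y.+1 nS.
move: (local_val true _ _ _) (local_val true _ _ _) (local_val false _ _ _)
  (local_val false _ _ _) => u' u w' w.
have sub01 (x : R) : 0 <= x <= 1 -> 0 <= 1 - x <= 1 by move=> /andP[? ?]; lra.
move=> wu' wu /sub01 u'01 /sub01 u01 /sub01 w'01 /sub01 w01.
have c01 : 0 <= chance R n <= 4^-1 by rewrite chance_le ltW// chance_gt0.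
have b01 : 0 <= rate R n y <= 16^-1 by rewrite rate_le rate_ge0.
have := loss_bound_climb b01 c01 u01 u'01 w01 w'01 wu (rate_climb yn w'01 wu').
move=> /(loss_bound_convex (rate_ge0 R n y) (q01 t) wu).
set s := (X in loss_bound _ X <= _); set l := (X in _ <= X) => sl.
rewrite (_ : 1 - _ = s); last by rewrite /s; ring.
by rewrite (_ : 1 - _ = l)// /l; ring.
Qed.

End local_survival.

Section example_runs.
Local Open Scope ring_scope.
Context (R : realType).
Local Notation M := (example R).
Local Notation origin := (origin R).
Implicit Types (s : place) (p : seq place) (f : place -> R).

Definition reachable : pred place := fun s =>
  match s with
  | (k, Some (Some x)) => odd k || (x <= (tick k./2).2)%N
  | (k, Some None) => odd k
  | _ => true
  end.

Lemma landing_reachable k x : reachable (landing k x).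
Proof. by rewrite /= /landing; case: (odd k) => //=; rewrite geq_minr. Qed.

Lemma succs_reachable s t : t \in succs R s -> reachable t.
Proof.
rewrite mem_undup mem_cat => /orP[].
  case: s => k [[x|]|] /=.
  - by rewrite inE => /eqP ->; exact: landing_reachable.
  - case: (tick _) => m y; rewrite !inE => /or3P[] /eqP ->//;
      exact: landing_reachable.
  - by rewrite inE => /eqP ->.
case: ifP => //; rewrite inE => so /eqP -> /=.
by case: s so => k [[x|]|] //= /and3P[].
Qed.

Lemma path_reachable p : path (@trans R M) origin p -> reachable (last origin p).
Proof.
case/lastP: p => // p t; rewrite rcons_path last_rcons => /andP[_].
exact: succs_reachable.
Qed.

Lemma path_size p : path (@trans R M) origin p -> (last origin p).1 = size p.
Proof. by move=> /path_step ->; rewrite add0n. Qed.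

Context (sigma : strategy M).
Local Notation k := (next_state sigma origin).

Lemma sum_moves p f : ~~ offered (last origin p) ->
  \sum_(t <- succs R (last origin p)) k p t * f t =
  \sum_(i <- moves R (last origin p)) i.1 * f i.2.
Proof.
move=> np; rewrite /next_state ifF; last exact/negbTE.
apply: sum_list_mass; first exact: undup_uniq.
by move=> t tm; rewrite mem_undup mem_cat tm.
Qed.

Definition try_at p : R := sigma origin p ((size p).+1, Some None).

Lemma sum_offered p f x : path (@trans R M) origin p ->
  offered (last origin p) -> (last origin p).2 = Some (Some x) ->
  \sum_(t <- succs R (last origin p)) k p t * f t =
  (1 - try_at p) * f ((size p).+1, Some (Some x)) +
  try_at p * f ((size p).+1, Some None).
Proof.
move=> pp po px; have := @next_state_total R M origin (succs R) (succs_uniq R) (fun _ _ => erefl)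
  sigma p pp.
rewrite /next_state ifT// /succs po; have := path_size pp.
move: po px; case: (last origin p) => n c po /= px np; rewrite {}px {c}np in po *.
case/and3P: po => /negbTE no _ _.
rewrite undup_id; last by rewrite /= inE xpair_eqE andbF.
by rewrite /= /landing /= no /= !big_cons !big_nil !addr0 => <-; rewrite addrK.
Qed.

Lemma try_at01 p : 0 <= try_at p <= 1.
Proof. by rewrite mass_ge0 distr_le1. Qed.

End example_runs.

(** * Potentials for a Markov strategy *)

Section markov_bound.
Local Open Scope ring_scope.
Context (R : realType).
Local Notation M := (example R).
Local Notation origin := (origin R).
Context (sigma : strategy M) (sigma_markov : randomized_markov sigma).
Implicit Types (s : place) (p : seq place).
Local Notation k := (next_state sigma origin).
Local Notation E := (@expect R M origin (succs R) sigma).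

Definition markov_try (t : nat) : R :=
  if pselect (exists p, [/\ path (@trans R M) origin p, size p = t.*2
    & offered (last origin p)]) is left e then try_at sigma (projT1 (cid e))
  else 0.

Lemma markov_try01 t : 0 <= markov_try t <= 1.
Proof.
by rewrite /markov_try; case: pselect => e; rewrite ?try_at01// lexx ler01.
Qed.

(** An offered state at step [2 t] has the level of tick [t], so all these histories end in the same
    state and a Markov strategy cannot tell them apart. Hence the history picked in [markov_try]
    does not matter. *)
Lemma markov_tryE p t : path (@trans R M) origin p -> size p = t.*2 ->
  offered (last origin p) -> try_at sigma p = markov_try t.
Proof.
move=> pp pt po; rewrite /markov_try; case: pselect => [e|[]]; last by exists p.
case: (cid e) => p' /= [pp' pt' po']; rewrite /try_at pt pt'.
have offeredE r : path (@trans R M) origin r -> size r = t.*2 ->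
    offered (last origin r) -> last origin r = (t.*2, Some (Some (tick t).2)).
  move=> /path_size + rt; rewrite rt.
  case: (last origin r) => n [[x|]|] //= ->.
  by rewrite doubleK => /and3P[_ /eqP ->].
have hp : history (M := M) origin p by apply/andP.
have hp' : history (M := M) origin p' by apply/andP.
apply: (sigma_markov hp hp'); first by rewrite pt pt'.
by rewrite (offeredE p pp pt po) (offeredE p' pp' pt' po').
Qed.

Context (T : nat).

Definition tail_val kappa t z : R := local_val markov_try kappa (T - t) t z.

(** A player at level [x] plays there until the next tick below [x], then goes on at a lower level,
    and so on down to 0. The values multiply because the later choices do not depend on what
    happened before; a level jumped over on the way down contributes a factor 1. *)
Definition level_val kappa t x : R := \prod_(z < x.+1) tail_val kappa t z.

(** The survival potential if [kappa] holds, the potential of not visiting otherwise; [uphalf k] is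
    the first tick at or after step [k]. *)
Definition place_val kappa s : R :=
  match s with
  | (k, None) => (~~ kappa)%:R
  | (k, Some None) =>
    let: (m, y) := tick k./2 in
    (~~ kappa)%:R * chance R m ^+ 2
    + chance R m * level_val kappa (uphalf k.+1) y.+1
    + (1 - chance R m - chance R m ^+ 2) * level_val kappa (uphalf k.+1) y
  | (k, Some (Some x)) => level_val kappa (uphalf k) x
  end.

Lemma tail_val01 kappa t z : 0 <= tail_val kappa t z <= 1.
Proof. exact/local_val01/markov_try01. Qed.

Lemma level_val01 kappa t x : 0 <= level_val kappa t x <= 1.
Proof.
rewrite /level_val; elim/big_rec: _ => [|z y _ /andP[y0 y1]].
  by rewrite ler01 lexx.
have /andP[v0 v1] := tail_val01 kappa t z.
by rewrite mulr_ge0// mulr_ile1.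
Qed.

Lemma tail_val_end kappa t z : (T <= t)%N -> tail_val kappa t z = 1.
Proof. by rewrite /tail_val -subn_eq0 => /eqP ->. Qed.

Lemma level_val_end kappa t x : (T <= t)%N -> level_val kappa t x = 1.
Proof. by move=> Tt; rewrite /level_val big1// => z _; exact: tail_val_end. Qed.

Lemma tail_valE kappa t z : (t < T)%N -> tail_val kappa t z =
  let: (m, y) := tick t in
  let v := tail_val kappa t.+1 in
  if (y < z)%N then 1
  else if (z < y)%N then v z
  else if y == width m then kappa%:R
  else (1 - markov_try t) * v z + markov_try t * (v z * (1 - chance R m
      - kappa%:R * chance R m ^+ 2 + chance R m * v z.+1)).
Proof. by rewrite /tail_val => tT; rewrite -(subnSK tT). Qed.

Lemma tail_val_above kappa t z : ((tick t).2 < z)%N -> tail_val kappa t z = 1.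
Proof.
have [tT|/tail_val_end ->//] := ltnP t T.
by rewrite tail_valE//; case: (tick t) => m y /= ->.
Qed.

Lemma tail_val_below kappa t z : (t < T)%N -> (z < (tick t).2)%N ->
  tail_val kappa t z = tail_val kappa t.+1 z.
Proof.
move=> tT; rewrite tail_valE//; case: (tick t) => m y /= zy.
by rewrite zy ifF// ltnNge ltnW.
Qed.

Lemma level_val_cut kappa t x :
  level_val kappa t (minn x (tick t).2) = level_val kappa t x.
Proof.
have [//|yx] := leqP x (tick t).2.
rewrite /level_val -!(big_mkord xpredT (tail_val kappa t)).
rewrite [RHS](big_cat_nat (n := (tick t).2.+1))//= ?ltnS 1?ltnW//.
rewrite [X in _ * X]big_nat [X in _ * X]big1 ?mulr1// => z /andP[yz _].
exact: tail_val_above.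
Qed.

Lemma place_val_landing kappa n x :
  place_val kappa (landing n x) = level_val kappa (uphalf n) x.
Proof.
rewrite /landing /=; case: ifPn => // /negbTE no.
by rewrite uphalf_half no add0n level_val_cut.
Qed.

Lemma level_val_below kappa t x : (t < T)%N -> (x < (tick t).2)%N ->
  level_val kappa t x = level_val kappa t.+1 x.
Proof.
move=> tT xy; apply: eq_bigr => z _; apply: tail_val_below => //.
by apply: leq_ltn_trans xy; rewrite -ltnS.
Qed.

Local Notation next kappa p :=
  (\sum_(t <- succs R (last origin p)) k p t * place_val kappa t).

Lemma place_val_random kappa p : path (@trans R M) origin p ->
  (size p < T.*2)%N -> ~~ offered (last origin p) -> ~~ goal (last origin p) ->
  next kappa p = place_val kappa (last origin p).
Proof.
move=> pp pT po; rewrite sum_moves//; have := path_reachable pp.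
move: po; have := path_size pp; case: (last origin p) => n c.
rewrite [X in X = _ -> _]/= => ->; case: c => [[x|]|] po pr pg.
- rewrite [moves _ _]/= big_seq1 mul1r place_val_landing /= uphalf_half.
  move: po pr pg => /=; case: (boolP (odd _)) => //= np.
  have nT : ((size p)./2 < T)%N by rewrite ltn_half_double.
  rewrite [(x <= (tick _).2)%N]leq_eqVlt => xN /orP[xy|xy] xw; last first.
    by rewrite -level_val_below.
  have := tick_le (size p)./2; rewrite -(eqP xy) leq_eqVlt.
  by move: xN xw; rewrite xy/= => /negbTE -> /negbTE ->.
- rewrite /= in pr; rewrite /=; case: (tick _) => m y.
  by rewrite !big_cons big_nil !place_val_landing/= addr0 mulrC addrA.
- by rewrite [moves _ _]/= big_seq1 mul1r.
Qed.

Lemma level_val_recr kappa t x :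
  level_val kappa t x.+1 = level_val kappa t x * tail_val kappa t x.+1.
Proof. by rewrite /level_val big_ord_recr. Qed.

(** For survival the two sides agree. For not visiting, the expectation gains on the fatal outcome:
    [local_val] lets the lost player carry on, whereas [place_val] rates this player 1. *)
Lemma place_val_offered kappa p : path (@trans R M) origin p ->
  (size p < T.*2)%N -> offered (last origin p) ->
  if kappa then next kappa p <= place_val kappa (last origin p)
  else place_val kappa (last origin p) <= next kappa p.
Proof.
move=> pp pT po.
have [x px] : exists x, (last origin p).2 = Some (Some x).
  by move: po; case: (last origin p) => n [[x|]|] //= _; exists x.
rewrite (sum_offered sigma (place_val kappa) pp po px).
have := markov_tryE pp _ po; have := path_size pp; move: po px.
case: (last origin p) => n c + /= cx; rewrite {}cx => /and3P[+ + + np].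
rewrite {n}np => /negbTE po /eqP xy xw.
have nT : ((size p)./2 < T)%N by rewrite ltn_half_double.
have pE : size p = (size p)./2.*2 by rewrite -{1}[size p]odd_double_half po.
move=> /(_ _ pE) -> //=.
rewrite !uphalf_half po/=; set t := (size p)./2 in xy xw nT *.
have qt := markov_try01 t; move: qt xy xw; set q := markov_try t.
move=> /andP[q0 q1] xy xw.
have -> : level_val kappa t x = (\prod_(z < x) tail_val kappa t.+1 z) *
    ((1 - q) * tail_val kappa t.+1 x + q * (tail_val kappa t.+1 x *
      (1 - chance R (tick t).1 - kappa%:R * chance R (tick t).1 ^+ 2 +
       chance R (tick t).1 * tail_val kappa t.+1 x.+1))).
  rewrite /level_val big_ord_recr/= tail_valE//; congr (_ * _).
    by apply: eq_bigr => z _; rewrite tail_val_below// -xy.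
  by case: (tick t) xy xw => m y /= <-; rewrite ltnn => xw; rewrite ltn_eqF.
have tE : level_val kappa t.+1 x =
    \prod_(z < x) tail_val kappa t.+1 z * tail_val kappa t.+1 x.
  by rewrite /level_val big_ord_recr.
have := level_val01 kappa t.+1 x.
case: (tick t) xy xw => m y /= <- _; rewrite level_val_recr tE.
move: (\prod_(z < x) _) (tail_val _ _ x) (tail_val _ _ x.+1) => A l l' /andP[_ Al].
case: kappa {tE} => /=.
  by rewrite -subr_ge0 (_ : _ - _ = 0)//; ring.
rewrite -subr_ge0 (_ : _ - _ = q * chance R m ^+ 2 * (1 - A * l)); last by ring.
by rewrite mulr_ge0 ?subr_ge0// mulr_ge0// sqr_ge0.
Qed.

Lemma place_val_goal p : path (@trans R M) origin p ->
  (size p < T.*2)%N -> goal (last origin p) ->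
  place_val false (last origin p) = 0 /\
  next true p <= place_val true (last origin p).
Proof.
move=> pp pT pg.
have po : ~~ offered (last origin p).
  move: pg; case: (last origin p) => n [[x|]|] //= /and3P[_ _ /eqP ->].
  by rewrite ltnn !andbF.
rewrite sum_moves//; move: pg {po}; have := path_size pp.
case: (last origin p) => n [[x|]|] //= -> /and3P[/negbTE po /eqP xy xw].
rewrite big_seq1 mul1r place_val_landing /= uphalf_half po add0n.
have nT : ((size p)./2 < T)%N by rewrite ltn_half_double.
set t := (size p)./2 in xy xw nT *.
have tE kappa : level_val kappa t x = (\prod_(z < x) tail_val kappa t.+1 z) * kappa%:R.
  rewrite /level_val big_ord_recr/= tail_valE//; congr (_ * _).
    by apply: eq_bigr => z _; rewrite tail_val_below// -xy.
  by case: (tick t) xy xw => m y /= <- ->; rewrite ltnn.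
rewrite !tE mulr0 mulr1; split=> //; rewrite /level_val big_ord_recr/=.
rewrite ler_piMr//; last by have /andP[] := tail_val01 true t.+1 x.
by apply: prodr_ge0 => z _; have /andP[] := tail_val01 true t.+1 z.
Qed.

End markov_bound.

(** * Visits bounded by losses over a time interval *)

Section markov_visits.
Local Open Scope ring_scope.
Context (R : realType).
Local Notation M := (example R).
Local Notation origin := (origin R).
Implicit Types (s : place) (p : seq place).

Definition alive : pred place := fun s => s.2 != None.

(** The last state is left out, so that appending a state adds the verdict on the state being
    left. *)
Definition visited (a : nat) p : bool := has goal (drop a (belast origin p)).

Lemma visited_rcons a p t : (a <= size p)%N ->
  visited a (rcons p t) = visited a p || goal (last origin p).
Proof.
move=> ap; rewrite /visited belast_rcons lastI drop_rcons ?size_belast//.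
by rewrite has_rcons orbC.
Qed.

Lemma visited_size p : visited (size p) p = false.
Proof. by rewrite /visited drop_oversize// size_belast. Qed.

Context (sigma : strategy M).
Local Notation k := (next_state sigma origin).
Local Notation E := (@expect R M origin (succs R) sigma).

Lemma example_expect_cst n c : E n (fun=> c) = c.
Proof. by apply: expect_cst => //; exact: succs_uniq. Qed.

Definition survival (n : nat) : R := E n (fun p => (alive (last origin p))%:R).

Hypothesis sigma_markov : randomized_markov sigma.

(** At a tick of level 0 all survivors stand at level 0, and no later tick is below it, so the local
    values [u] and [w] cover the whole time up to [T]. Survival is multiplied by at most [u], a
    visit has probability at most [1 - w] times the survival at the start, and [local_ratio] gives
    [1 - w <= 16 * (1 - u)]. *)
Lemma markov_visit_bound t T : (tick t).2 = 0%N -> (t <= T)%N ->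
  E T.*2 (fun p => (visited t.*2 p)%:R) <= 16 * (survival t.*2 - survival T.*2).
Proof.
move=> t0 tT; have tT2 : (t.*2 <= T.*2)%N by rewrite leq_double.
pose V := place_val sigma T.
pose u := tail_val sigma T true t 0; pose w := tail_val sigma T false t 0.
have V_start kappa p : path (@trans R M) origin p -> size p = t.*2 ->
    V kappa (last origin p) = if alive (last origin p)
      then tail_val sigma T kappa t 0 else (~~ kappa)%:R.
  move=> pp pt; have := path_reachable pp; have := path_size pp; rewrite pt.
  case: (last origin p) => n [[x|]|] //= ->; rewrite odd_double//= doubleK t0.
  rewrite leqn0 => /eqP ->; rewrite uphalf_double.
  by rewrite /level_val big_ord1.
have V_end kappa p : path (@trans R M) origin p -> size p = T.*2 ->
    V kappa (last origin p) = if alive (last origin p) then 1 else (~~ kappa)%:R.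
  move=> pp pt; have := path_reachable pp; have := path_size pp; rewrite pt.
  case: (last origin p) => n [[x|]|] //= ->; rewrite odd_double//= => _.
  by rewrite uphalf_double level_val_end.
have survival_le : survival T.*2 <= u * survival t.*2.
  apply: (@le_trans _ _ (E T.*2 (fun p => V true (last origin p)))).
    by apply: expect_le => // p pp pT; rewrite V_end//; case: ifP.
  apply: (@le_trans _ _ (E t.*2 (fun p => V true (last origin p)))).
    apply: expect_supermartingale => // p pp /andP[_ pT].
    under eq_bigr do rewrite last_rcons.
    case: (boolP (offered (last origin p))) => po.
      exact: (place_val_offered sigma_markov true).
    case: (boolP (goal (last origin p))) => pg.
      by have [] := place_val_goal sigma pp pT pg.
    by rewrite place_val_random.
  rewrite -expectZ; apply: expect_le => // p pp pt; rewrite V_start//.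
  by case: ifP => _; rewrite ?mulr1 ?mulr0.
have visit_ge : 1 + (w - 1) * survival t.*2 <=
    E T.*2 (fun p => (~~ visited t.*2 p)%:R).
  (* The potential vanishes at a goal, so discarding the paths with a visit keeps the submartingale
     property. *)
  pose f p := (~~ visited t.*2 p)%:R * V false (last origin p).
  apply: (@le_trans _ _ (E T.*2 f)); last first.
    apply: expect_le => // p pp pT; rewrite /f V_end//.
    by case: ifP; rewrite mulr1.
  apply: (@le_trans _ _ (E t.*2 f)).
    rewrite -[X in X + _ <= _](example_expect_cst t.*2 1).
    rewrite -expectZ -expectD; apply: expect_le => // p pp pt /=; rewrite /f V_start//.
    rewrite -pt visited_size mul1r.
    by case: ifP => _; rewrite ?mulr1 ?mulr0 ?addr0// addrC subrK.
  apply: expect_submartingale => // p pp /andP[tp pT].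
  under eq_bigr => s _ do rewrite /f visited_rcons// last_rcons mulrCA.
  rewrite -mulr_sumr /f; case: (visited _ _) => /=; first by rewrite !mul0r.
  rewrite mul1r; case: (boolP (goal (last origin p))) => pg /=.
    by have [v0 _] := place_val_goal sigma pp pT pg; rewrite /V v0 mul0r.
  rewrite mul1r; case: (boolP (offered (last origin p))) => po.
    exact: (place_val_offered sigma_markov false).
  by rewrite place_val_random.
have := example_expect_cst T.*2 1.
rewrite (_ : E T.*2 _ = E T.*2 (fun p => (visited t.*2 p)%:R) +
    E T.*2 (fun p => (~~ visited t.*2 p)%:R)); last first.
  rewrite -expectD; apply: eq_bigr => p _ /=; congr (_ * _).
  by case: (visited _ _); rewrite ?addr0 ?add0r.
have : 0 <= survival t.*2.
  rewrite -(example_expect_cst t.*2 0).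
  by apply: expect_le.
have := @local_ratio R (markov_try sigma) (markov_try01 sigma) (T - t) t
  (tick t).1 0 (or_introl erefl).
rewrite rate0 /loss_bound -/(tail_val sigma T true t 0) -/(tail_val sigma T false t 0).
rewrite -/u -/w => uw; have := sqr_ge0 (1 - w) => w2 a0 v1.
have uw' : (1 - w) <= 16 * (1 - u) by lra.
have : (1 - w) * survival t.*2 <= 16 * (1 - u) * survival t.*2 by rewrite ler_wpM2r.
lra.
Qed.

End markov_visits.

(** * Strategies with memory *)

Section phase_success.
Local Open Scope ring_scope.
Context (R : realType) (m : nat).
Local Notation c := (chance R m).
Local Notation N := (width m).
Implicit Types (w : seq nat) (x y : nat).

Definition climb (v : nat -> R) y : R := c * v y.+1 + (1 - c - c ^+ 2) * v y.

(** The probability that a player at level [x] who tries at every opportunity visits the goal during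
    the ticks [w]. *)
Fixpoint hit w x : R :=
  if w is y :: w' then
    if (x < y)%N then hit w' x else if y == N then 1 else climb (hit w') y
  else 0.

Lemma hit_cut y w x : hit (y :: w) (minn x y) = hit (y :: w) x.
Proof. by case: (ltnP x y) => [xy|yx] /=; rewrite ?xy// ltnn ltnNge yx. Qed.

Lemma climb_ge0 v y : 0 <= v y -> 0 <= v y.+1 -> 0 <= climb v y.
Proof.
move=> v0 v1; have c0 := chance_gt0 R m; have c1 := chance_le R m.
by rewrite addr_ge0// mulr_ge0 ?(ltW c0)//; nra.
Qed.

Lemma hit_ge0 w x : 0 <= hit w x.
Proof.
elim: w x => //= y w IH x; case: ifP => // _; case: ifP => // _.
exact: climb_ge0.
Qed.

Lemma hit_idle w w' x : {in w, forall y, x < y}%N -> hit (w ++ w') x = hit w' x.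
Proof.
elim: w => //= y w IH xw; rewrite xw ?mem_head//; apply: IH => z zw.
by apply: xw; rewrite inE zw orbT.
Qed.

(** By Bernoulli [(1 - c) ^+ n * (1 + n%:R * c) <= 1], and for [n = N ^ 4] the product [n%:R * c] is
    [c^-1]. *)
Lemma expr_chance_le : (1 - c) ^+ (N ^ 4) <= c.
Proof.
have c0 := chance_gt0 R m; have c1 := chance_le R m; have Nc := width_chance R m.
have le n : (1 - c) ^+ n * (1 + n%:R * c) <= 1.
  elim: n => [|n IH]; first by rewrite mul0r addr0 mulr1.
  apply: le_trans IH; rewrite exprSr -mulrA ler_wpM2l ?exprn_ge0//; first by lra.
  rewrite -natr1; have : 0 <= n%:R :> R by [].
  nra.
have := le (N ^ 4)%N; have N2 : N%:R ^+ 2 = c^-1 :> R by rewrite invrK.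
have -> : (N ^ 4)%:R * c = c^-1 :> R.
  by rewrite natrX (exprM _ 2 2) N2 expr2 mulfVK// gt_eqF.
have : 0 <= (1 - c) ^+ (N ^ 4) by rewrite exprn_ge0//; lra.
move: (_ ^+ _) => a a0.
have : c * (1 + c^-1) = c + 1 by rewrite mulrDr mulr1 divff// gt_eqF.
move: (c^-1) => ic ici ai.
have : c * (a * (1 + ic)) <= c * 1 by rewrite ler_wpM2l// ltW.
rewrite mulrCA ici; nra.
Qed.

(** At one level the odds of climbing against dying are [c] to [c ^+ 2], so a climb comes first with
    probability at least [1 - c]. Running out of repetitions costs at most another factor [1 - c],
    and [(1 - c) ^+ 2 >= 1 - 2 * c] is the price of a level. *)
Lemma hit_lane j w x : (j <= N)%N -> (N - j <= x)%N ->
  (1 - 2 * c) ^+ j <= hit (lane N (N ^ 4) j ++ w) x.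
Proof.
have c0 := chance_gt0 R m; have c1 := chance_le R m.
elim: j w x => [|j IH] w x jN jx.
  by rewrite subn0 in jx; rewrite /= ltnNge jx eqxx expr0.
set rho := (1 - 2 * c) ^+ j; have rho0 : 0 <= rho by rewrite exprn_ge0//; lra.
have [y yE] : exists y, (N - j.+1 = y)%N by exists (N - j.+1)%N.
have yN : (y < N)%N by lia.
have yS : (N - j = y.+1)%N by lia.
(* With [n] repetitions left: a climb leaves the inner lane to the induction hypothesis, and after a
   failed attempt the inner lane is idle because its ticks are all above [y]. *)
rewrite yE in jx; have copies n : forall x, (y <= x)%N ->
    rho * (1 - c) * (1 - (1 - c) ^+ n) <=
    hit (flatten (nseq n (y :: lane N (N ^ 4) j)) ++ w) x.
  elim: n => [|n IHn] x' yx; first by rewrite subrr mulr0 hit_ge0.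
  rewrite [nseq _ _]/= [flatten _]/= -!cat_cons -catA cat_cons.
  set r := flatten _ ++ w in IHn *.
  rewrite [leRHS]/= ltnNge yx /= (ltn_eqF yN) /climb.
  have r1 : rho <= hit (lane N (N ^ 4) j ++ r) y.+1 by apply: IH; lia.
  have r2 : rho * (1 - c) * (1 - (1 - c) ^+ n) <= hit (lane N (N ^ 4) j ++ r) y.
    rewrite hit_idle; first exact: IHn.
    by move=> z /lane_bounds => /(_ (ltnW jN)) /andP[+ _]; rewrite yS.
  apply: (@le_trans _ _ (c * rho +
      (1 - c - c ^+ 2) * (rho * (1 - c) * (1 - (1 - c) ^+ n)))); last first.
    rewrite lerD// ler_wpM2l//; first exact: ltW.
    nra.
  rewrite exprS; have : 0 <= (1 - c) ^+ n by rewrite exprn_ge0//; lra.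
  move: (_ ^+ n) => z z0; rewrite -subr_ge0.
  rewrite (_ : _ - _ = rho * (c ^+ 3 + (1 - c) * c ^+ 2 * z)); last by ring.
  rewrite mulr_ge0// addr_ge0// ?exprn_ge0 ?(ltW c0)//.
  by rewrite mulr_ge0// mulr_ge0// ?sqr_ge0//; lra.
rewrite [lane _ _ _]/= yE; apply: le_trans (copies _ _ jx).
have := expr_chance_le; move: (_ ^+ (_ ^ _)) => z zc.
rewrite exprSr -/rho -mulrA ler_wpM2l//.
by nra.
Qed.

(** Bernoulli's inequality for the [N] levels, with [N%:R * (2 * c) = 2 / N%:R = 2 ^- m]. *)
Lemma hit_word x : 1 - 2 ^- m <= hit (word m) x.
Proof.
have c0 := chance_gt0 R m; have c1 := chance_le R m.
have := @hit_lane N [::] x (leqnn _); rewrite subnn cats0 => /(_ isT).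
apply: le_trans.
have bern n : 1 - n%:R * (2 * c) <= (1 - 2 * c) ^+ n.
  elim: n => [|n IH]; first by rewrite mul0r subr0.
  rewrite exprS -natr1.
  have : (1 - 2 * c) * (1 - n%:R * (2 * c)) <= (1 - 2 * c) * (1 - 2 * c) ^+ n.
    by rewrite ler_wpM2l//; lra.
  by apply: le_trans; have : 0 <= n%:R :> R by []; nra.
apply: le_trans (bern N); rewrite lerD2l lerN2.
have Nc := width_chance R m; have N0 : N%:R != 0 :> R.
  by rewrite pnatr_eq0 -lt0n (ltn_trans _ (width_gt1 m)).
have -> : N%:R * (2 * c) = 2 / N%:R.
  by rewrite /chance; field.
by rewrite /width natrX exprS invfM mulrA divff// mul1r.
Qed.

End phase_success.

(** * The strategy that tries until the first visit in each phase *)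

Section memory_strategy.
Local Open Scope ring_scope.
Context (R : realType) (m0 : nat).
Local Notation M := (example R).
Local Notation origin := (origin R).
Implicit Types (s t : place) (p : seq place).

Definition wants_try (s : place) p : bool :=
  let m := (tick (last s p).1./2).1 in
  (m0 <= m)%N && ~~ has goal (drop (start m).*2 (belast s p)).

Definition memory_choice (s : place) p : distr R place :=
  let: (k, c) := last s p in
  dirac_distr R (k.+1, if wants_try s p then Some None else c).

Lemma memory_choice_succ (s : M) (p : seq M) t : history s p ->
  memory_choice s p t != 0 -> trans (last s p) t.
Proof.
move=> /andP[_]; rewrite /memory_choice; move: (wants_try s p) => b.
case: (last s p) => k c po.
rewrite dirac_distrE pnatr_eq0 eqb0 negbK => /eqP ->.
rewrite /trans /= mem_undup mem_cat.
have po' : offered (k, c) by [].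
rewrite po'; case: b; apply/orP; first by right; exact: mem_head.
left; move: po'; case: c {po} => [[x|]|] //= /andP[ko _].
by rewrite /landing /= ko; exact: mem_head.
Qed.

Definition memory_strategy : strategy M :=
  @Strategy R M memory_choice memory_choice_succ.

Local Notation sigma := memory_strategy.
Local Notation k := (next_state sigma origin).
Local Notation E := (@expect R M origin (succs R) sigma).

Lemma sum_memory p (f : place -> R) : path (@trans R M) origin p ->
  offered (last origin p) ->
  \sum_(t <- succs R (last origin p)) k p t * f t =
  f ((size p).+1, if wants_try origin p then Some None else (last origin p).2).
Proof.
move=> pp po.
have [x px] : exists x, (last origin p).2 = Some (Some x).
  by move: po; case: (last origin p) => n [[x|]|] //= _; exists x.
rewrite (sum_offered sigma f pp po px) px.
have -> : try_at sigma p = (wants_try origin p)%:R.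
  rewrite /try_at (_ : sigma origin p = memory_choice origin p)// /memory_choice.
  have := path_size pp; move: px; move: (wants_try origin p) => b.
  case: (last origin p) => n c; rewrite [_.2]/= [_.1]/= => -> ->.
  rewrite dirac_distrE; congr (_%:R).
  by rewrite xpair_eqE eqxx; case: b.
by case: wants_try; rewrite ?subrr ?subr0 !(mul0r, mul1r) ?add0r ?addr0.
Qed.

(** Leaving out pending attempts makes this property persist as long as nothing is tried
    ([sum_settled]); at even steps it agrees with [alive]. *)
Definition settled : pred place := fun s =>
  if s is (_, Some (Some _)) then true else false.

Lemma settled_alive p : path (@trans R M) origin p -> ~~ odd (size p) ->
  alive (last origin p) = settled (last origin p).
Proof.
move=> pp; have := path_reachable pp; have := path_size pp.
by case: (last origin p) => n [[x|]|] //= -> ->.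
Qed.

Lemma sum_settled p : path (@trans R M) origin p ->
  ~~ (offered (last origin p) && wants_try origin p) ->
  ((settled (last origin p))%:R : R) <=
  \sum_(t <- succs R (last origin p)) k p t * (settled t)%:R.
Proof.
move=> pp np; have [st|_] := boolP (settled (last origin p)); last first.
  by apply: sumr_ge0 => t _; rewrite mulr_ge0// mass_ge0.
case: (boolP (offered (last origin p))) np => po /= np.
  rewrite (sum_memory (fun t => (settled t)%:R) pp po) (negbTE np).
  by move: st; case: (last origin p) => n [[x|]|].
rewrite (sum_moves sigma (fun t => (settled t)%:R) po).
move: st; case: (last origin p) => n [[x|]|] //= _.
by rewrite big_seq1 mul1r.
Qed.

Lemma survival_start : survival sigma (start m0).*2 = 1.
Proof.
apply/eqP; rewrite eq_le; apply/andP; split.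
  rewrite -(example_expect_cst sigma (start m0).*2 1); apply: expect_le => // p _ _.
  by case: alive; rewrite ?lexx ?ler01.
have := @expect_submartingale R M origin (succs R) (fun _ _ => erefl) sigma
  (fun p => (settled (last origin p))%:R) 0 (start m0).*2 (leq0n _).
rewrite expect0 /= => le; apply: le_trans (le _) _.
  move=> p pp pm; under eq_bigr do rewrite last_rcons.
  apply: sum_settled => //; rewrite negb_and /wants_try path_size//.
  have [n [i [im ti]]] := phaseP (size p)./2; rewrite ti tick_start//=.
  rewrite (_ : (m0 <= n)%N = false) ?orbT//; apply/negbTE; rewrite -ltnNge.
  rewrite ltnNge; apply/negP => /start_mono mn.
  have : (start m0 <= (size p)./2)%N by rewrite ti (leq_trans mn)// leq_addr.
  by rewrite geq_half_double leqNgt pm.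
apply: expect_le => // p pp _; rewrite /alive.
by case: (last origin p) => n [[x|]|].
Qed.

Section phase.
Variable m : nat.
Hypothesis m0m : (m0 <= m)%N.
Local Notation T0 := (start m).*2.

Definition hope (s : place) : R :=
  match s with
  | (_, None) => 0
  | (k, Some None) => climb m (hit R m (drop (uphalf k.+1 - start m) (word m)))
                        (tick k./2).2
  | (k, Some (Some x)) => hit R m (drop (uphalf k - start m) (word m)) x
  end.

(** Before the visit, the chance to succeed in the rest of the phase; after it, the player skips
    until the phase ends and only has to remain settled. *)
Definition phase_val p : R :=
  if visited R T0 p then (settled (last origin p))%:R else hope (last origin p).

Lemma hope_landing n x :
  (T0 <= n <= (start m.+1).*2)%N ->
  hope (landing n x) = hit R m (drop (uphalf n - start m) (word m)) x.
Proof.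
move=> /andP[mn nm]; rewrite /landing /=; case: (boolP (odd n)) => // /negbTE no.
rewrite uphalf_half no add0n.
have mn' : (start m <= n./2)%N by rewrite geq_half_double.
(* At the end of the phase the cut is made by a tick of the next phase, but no ticks of this phase
   remain and both sides are 0. *)
have [im|mi] := ltnP (n./2 - start m) (size (word m)); last by rewrite drop_oversize.
rewrite (drop_nth 0)//; have := tick_start im; rewrite subnKC// => ->.
by rewrite hit_cut.
Qed.

Lemma phase_val_step p : path (@trans R M) origin p ->
  (T0 <= size p < (start m.+1).*2)%N ->
  phase_val p <= \sum_(t <- succs R (last origin p)) k p t * phase_val (rcons p t).
Proof.
move=> pp /andP[mp pm]; rewrite /phase_val.
under eq_bigr do rewrite visited_rcons// last_rcons.
have mt : (start m <= (size p)./2)%N by rewrite geq_half_double.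
have im : ((size p)./2 - start m < size (word m))%N.
  by rewrite ltn_subLR// -startS ltn_half_double.
have tE := tick_start im; rewrite subnKC// in tE.
have := drop_nth 0 im; move: tE; set y := nth 0 _ _; set w := drop _.+1 _ => tE wE.
have wS : w = drop ((size p)./2.+1 - start m) (word m) by rewrite subSn.
have sE := path_size pp.
have wantsE : wants_try origin p = ~~ visited R T0 p.
  by rewrite /wants_try sE tE m0m.
case: (boolP (visited R T0 p)) wantsE => /= v wantsE.
  by apply: sum_settled => //; rewrite wantsE andbF.
case: (boolP (goal (last origin p))) => pg.
  have po : ~~ offered (last origin p).
    move: pg; case: (last origin p) => n [[x|]|] //= /and3P[_ _ /eqP ->].
    by rewrite ltnn !andbF.
  rewrite (sum_moves sigma (fun t => (settled t)%:R) po); move: pg sE.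
  case: (last origin p) => n [[x|]|] //= /and3P[/negbTE no xy xN] nE.
  rewrite big_seq1 mul1r uphalf_half {}nE in no xy xN *.
  rewrite no add0n wE /=; move: xy xN; rewrite tE/= => /eqP <- ->.
  by rewrite ltnn.
case: (boolP (offered (last origin p))) => po.
  rewrite (sum_memory hope pp po) wantsE; move: po pg sE.
  case: (last origin p) => n [[x|]|] //= /and3P[/negbTE no /eqP xy xN] _ nE.
  rewrite {}nE in no xy xN *; rewrite /= !uphalf_half no /= !add0n wE tE -wS /=.
  by move: xN; rewrite xy tE /= => xN; rewrite ltnn ltn_eqF.
rewrite (sum_moves sigma hope po); move: po pg sE (path_reachable pp).
case: (last origin p) => n [[x|]|] /=; last by rewrite big_seq1 mul1r.
  move=> po pg nE; rewrite {}nE in po pg *; rewrite big_seq1 mul1r.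
  rewrite hope_landing ?(leqW mp)//; move: po pg.
  rewrite /= !uphalf_half; case: (boolP (odd _)) => //= np.
  rewrite add0n tE /= => xN xw xy; rewrite wE -wS /= ifT//.
  rewrite ltn_neqAle xy andbT; apply/negP => xy'.
  move: xN xw (tick_le (size p)./2); rewrite tE xy' (eqP xy') /=.
  by case: ltngtP.
move=> _ _ nE; rewrite {}nE => /= np; rewrite tE /=.
rewrite !big_cons big_nil !hope_landing ?(leqW mp)//= mulr0 add0r addr0.
exact: lexx.
Qed.

Lemma phase_val_start : (1 - 2 ^- m) * survival sigma T0 <= E T0 phase_val.
Proof.
rewrite /survival -expectZ; apply: expect_le => // p pp pT.
rewrite settled_alive ?pT ?odd_double// /phase_val -{1}pT visited_size.
have := path_size pp; rewrite pT; case: (last origin p) => n [[x|]|] /= nE.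
- by rewrite nE uphalf_double subnn drop0 mulr1 hit_word.
- by rewrite mulr0n mulr0 climb_ge0// hit_ge0.
- by rewrite mulr0n mulr0.
Qed.

Lemma phase_val_end p : path (@trans R M) origin p ->
  size p = (start m.+1).*2 ->
  phase_val p <= (visited R T0 p && alive (last origin p))%:R.
Proof.
move=> pp pT; rewrite settled_alive ?pT ?odd_double// /phase_val.
case: (visited R T0 p) => //=.
have := path_size pp; have := path_reachable pp; rewrite pT.
case: (last origin p) => n [[x|]|] //= + nE; rewrite nE ?odd_double//.
by rewrite uphalf_double startS addKn drop_size.
Qed.

Lemma phase_success : (1 - 2 ^- m) * survival sigma T0 <=
  E (start m.+1).*2 (fun p => (visited R T0 p && alive (last origin p))%:R).
Proof.
apply: le_trans phase_val_start _.
have mm : (T0 <= (start m.+1).*2)%N by rewrite leq_double start_mono.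
apply: (@le_trans _ _ (E (start m.+1).*2 phase_val)).
  apply: expect_submartingale => // p; exact: phase_val_step.
by apply: expect_le => //; exact: phase_val_end.
Qed.

End phase.

(** The subtracted term is the sum of the failure bounds [2 ^- (m0 + i)] over [i < d]. *)
Let survival_bound d : R := 1 - (2 - 2 * 2 ^- d) * 2 ^- m0.

Let phase_bound d : survival_bound d <= survival sigma (start (m0 + d)).*2 ->
  survival_bound d.+1 <= E (start (m0 + d).+1).*2
    (fun p => (visited R (start (m0 + d)).*2 p && alive (last origin p))%:R).
Proof.
rewrite /survival_bound => IH; apply: le_trans (phase_success (leq_addr d m0)).
have inv_le1 n : 2 ^- n <= 1 :> R.
  by rewrite invf_le1 ?exprn_gt0// exprn_ege1// ler1n.
have a1 := inv_le1 (m0 + d)%N.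
have b0 : 0 <= (2 - 2 * 2 ^- d) * 2 ^- m0 :> R.
  by rewrite mulr_ge0 ?invr_ge0 ?exprn_ge0// subr_ge0 ler_piMr.
have : (1 - 2 ^- (m0 + d)) * (1 - (2 - 2 * 2 ^- d) * 2 ^- m0) <=
    (1 - 2 ^- (m0 + d)) * survival sigma (start (m0 + d)).*2.
  by rewrite ler_wpM2l// subr_ge0.
apply: le_trans.
have -> : 2 - 2 * 2 ^- d.+1 = 2 - 2 ^- d :> R.
  by rewrite exprS invfM mulrA divff ?mul1r// pnatr_eq0.
have ab : 2 ^- (m0 + d) = 2 ^- d * 2 ^- m0 :> R by rewrite exprD invfM mulrC.
rewrite ab in a1 *; have : 0 <= 2 ^- d * 2 ^- m0 :> R.
  by rewrite mulr_ge0// invr_ge0 exprn_ge0.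
by move: b0 a1; move: (2 ^- d) (2 ^- m0) => a b; nra.
Qed.

Let survival_ge d : survival_bound d <= survival sigma (start (m0 + d)).*2.
Proof.
elim: d => [|d /phase_bound IH].
  by rewrite addn0 survival_start /survival_bound expr0 invr1 mulr1 subrr mul0r subr0.
apply: le_trans IH _; rewrite addnS; apply: expect_le => // p _ _.
by case: visited => //=; rewrite ler0n.
Qed.

Lemma memory_visit_bound m : (m0 <= m)%N ->
  1 - 2 * 2 ^- m0 <= E (start m.+1).*2 (fun p => (visited R (start m).*2 p)%:R).
Proof.
move=> /subnKC <-; move: (m - m0)%N => d.
apply: (@le_trans _ _ (survival_bound d.+1)).
  rewrite lerD2l lerN2 ler_wpM2r ?invr_ge0 ?exprn_ge0//.
  by rewrite gerBl mulr_ge0// invr_ge0 exprn_ge0.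
apply: le_trans (phase_bound (survival_ge d)) _; apply: expect_le => // p _ _.
by case: visited => //=; case: alive; rewrite ?ler01.
Qed.

End memory_strategy.

(** * The Büchi and limsup events *)

Section events.
Context (R : realType).
Local Notation M := (example R).
Local Notation origin := (origin R).
Implicit Types (rho : runs origin).

Definition goal_set : set M := [set s | goal s].

(** The rewards are 1 at goals and -1 elsewhere, so the supremum of a tail is nonnegative exactly
    when the tail still meets a goal. *)
Lemma limsup_ge0_buchi : limsup_ge0 origin = buchi origin goal_set.
Proof.
apply/seteqP; split=> rho; rewrite /limsup_ge0 /buchi /= limn_esup_lim; last first.
  move=> io; apply: lime_ge; first exact: is_cvg_esups.
  apply: nearW => n; have [m nm gm] := io n.
  apply: (@le_trans _ _ 1); first exact: lee01.
  by apply: ereal_sup_ubound; exists m => //=; rewrite gm.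
move=> lim0 n; apply: contrapT => nogoal.
suff : limn (esups (fun n => (reward (rho n) (rho n.+1))%:E)) <= (-1)%:E.
  by move=> /(le_trans lim0); rewrite lee_fin; lra.
apply: lime_le; first exact: is_cvg_esups.
exists n => // m /= nm; apply: ge_ereal_sup => _ [i /= mi <-].
rewrite ifF//; apply/negP => gi; apply: nogoal.
by exists i => //; apply: leq_trans mi.
Qed.

(** A run is an arbitrary sequence and may start elsewhere, while paths start in [origin]; hence the
    exception at 0 and the positive [a] in [visited_prefix]. *)
Lemma belast_prefix b rho : belast origin (run_prefix b rho) =
  mkseq (fun i => if i is 0%N then origin else rho i) b.
Proof.
apply: (@eq_from_nth _ origin); first by rewrite size_belast !size_mkseq.
move=> i; rewrite size_belast size_mkseq => ib; rewrite nth_mkseq//.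
have := nth_rcons origin (belast origin (run_prefix b rho))
  (last origin (run_prefix b rho)) i.
rewrite -lastI size_belast size_mkseq ib => <-.
by case: i ib => //= i ib; rewrite nth_mkseq// ltnW.
Qed.

Lemma visited_prefix a b rho : (0 < a)%N ->
  visited R a (run_prefix b rho) <-> exists i, (a <= i < b)%N /\ goal (rho i).
Proof.
move=> a0; rewrite /visited belast_prefix; split.
  move=> /(has_nthP origin)[j]; rewrite size_drop size_mkseq nth_drop => jb.
  have ib : (a + j < b)%N by rewrite -ltn_subRL.
  rewrite nth_mkseq//; move: ib (leq_addr j a).
  case: (a + j)%N => [|i] ib ai gi; first by rewrite leqNgt a0 in ai.
  by exists i.+1; rewrite ai ib.
move=> [i [/andP[ai ib] gi]]; apply/(has_nthP origin); exists (i - a)%N.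
  by rewrite size_drop size_mkseq ltn_sub2r// (leq_ltn_trans ai ib).
rewrite nth_drop subnKC// nth_mkseq//.
by case: i ai gi {ib} => //; rewrite leqNgt a0.
Qed.

Definition visits_from a : set (runs origin) :=
  [set rho | exists2 i, (a <= i)%N & goal (rho i)].

Lemma measurable_visits_from a : measurable (visits_from a).
Proof.
have -> : visits_from a =
    \bigcup_(i in [set i | (a <= i)%N]) [set rho : runs origin | goal (rho i)].
  by apply/seteqP; split=> rho [i]; exists i.
apply: bigcup_measurable => i _; apply: (@measurable_determined _ _ _ i.+1) => x y xy.
by rewrite /= xy.
Qed.

Lemma buchiE : buchi origin goal_set = \bigcap_n visits_from n.
Proof. by apply/seteqP; split=> rho io n => [_|]; apply: io. Qed.

Lemma measurable_buchi : measurable (buchi origin goal_set).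
Proof.
by rewrite buchiE; apply: bigcap_measurable => // n _; exact: measurable_visits_from.
Qed.

Lemma run_law_visited (sigma : strategy M) a n :
  run_law origin sigma [set rho : runs origin | visited R a (run_prefix n rho)] =
  (@expect R M origin (succs R) sigma n (fun p => (visited R a p)%:R))%:E.
Proof. by apply: run_law_prefix => //; exact: succs_uniq. Qed.

Lemma start_double_gt0 m : (0 < m)%N -> (0 < (start m).*2)%N.
Proof. by move=> m0; rewrite double_gt0 (leq_trans m0)// leq_start. Qed.

(** Letting the horizon grow in [markov_visit_bound], a visit after the start of phase [m.+1] has
    probability at most 16 times the distance of [a m] from the infimum of [a], which is small for a
    suitable [m]. *)
Lemma markov_buchi (sigma : strategy M) : randomized_markov sigma ->
  run_law origin sigma (buchi origin goal_set) = 0.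
Proof.
move=> sigma_markov; set P := run_law origin sigma.
pose a m := survival sigma (start m.+1).*2.
have a_ge0 m : (0 <= a m)%R.
  by rewrite -(example_expect_cst sigma (start m.+1).*2 0); apply: expect_le.
have a_inf : has_inf (range a).
  by split; [exists (a 0%N); exists 0%N|exists 0%R => _ [m _ <-]].
have visits_le m : P (visits_from (start m.+1).*2) <= (16 * (a m - inf (range a)))%:E.
  pose V n := [set rho : runs origin |
    visited R (start m.+1).*2 (run_prefix (start n.+1).*2 rho)].
  have VE : visits_from (start m.+1).*2 = \bigcup_n V n.
    apply/seteqP; split=> rho.
      move=> [i mi gi]; exists i => //; apply/visited_prefix.
        exact: start_double_gt0.
      exists i; rewrite mi gi; split=> //; have := leq_start i.+1.
      by rewrite -addnn; move: (start _) => s; lia.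
    move=> [n _] /visited_prefix => /(_ (start_double_gt0 (ltn0Sn m)))[i [/andP[mi _] gi]].
    by exists i.
  have V_cvg : (P \o V) n @[n --> \oo] --> P (\bigcup_n V n).
    apply: nondecreasing_cvg_mu.
    - by move=> n; exact: measurable_prefix.
    - by rewrite -VE; exact: measurable_visits_from.
    move=> n n' nn'; apply/subsetPset => rho.
    move=> /visited_prefix => /(_ (start_double_gt0 (ltn0Sn m)))[i [/andP[mi ni] gi]].
    apply/visited_prefix; first exact: start_double_gt0.
    exists i; rewrite mi gi (leq_trans ni)// leq_double.
    exact: start_mono.
  rewrite VE -(cvg_lim _ V_cvg)//; apply: lime_le.
    by apply/cvg_ex; eexists; exact: V_cvg.
  exists m => // n /= mn; rewrite /V run_law_visited lee_fin.
  have m0 : (tick (start m.+1)).2 = 0%N by rewrite tick_start0.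
  have mn' : (start m.+1 <= start n.+1)%N by exact: start_mono.
  apply: le_trans (markov_visit_bound sigma_markov m0 mn') _.
  rewrite ler_wpM2l// lerD2l lerN2; apply: ge_inf; first exact: a_inf.2.
  by exists n.
apply/eqP; rewrite eq_le measure_ge0 andbT; apply/lee_addgt0Pr => e e0.
rewrite add0e; have e16 : (0 < e / 16)%R by rewrite divr_gt0.
have [_ [m _ <-] am] := inf_adherent e16 a_inf.
apply: le_trans (le_trans (visits_le m) _); last by rewrite lee_fin; lra.
apply: le_measure; rewrite ?inE; first exact: measurable_buchi.
  exact: measurable_visits_from.
by rewrite buchiE => rho; apply.
Qed.

(** Each [visits_from n] contains the event of a visit in some late phase, whose probability is
    bounded below independently of [n]; continuity from above gives the bound for the
    intersection. *)
Lemma memory_buchi m0 : (1 - 2 * 2 ^- m0)%:E <=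
  run_law origin (memory_strategy R m0) (buchi origin goal_set).
Proof.
set P := run_law origin _; rewrite buchiE.
have D_cvg : (P \o visits_from) n @[n --> \oo] --> P (\bigcap_n visits_from n).
  apply: nonincreasing_cvg_mu.
  - by rewrite -ge0_fin_numE//; apply: fin_num_measure; exact: measurable_visits_from.
  - by move=> n; exact: measurable_visits_from.
  - by rewrite -buchiE; exact: measurable_buchi.
  move=> n n' nn'; apply/subsetPset => rho [i ni gi].
  by exists i => //; apply: leq_trans ni.
rewrite -(cvg_lim _ D_cvg)//; apply: lime_ge.
  by apply/cvg_ex; eexists; exact: D_cvg.
apply: nearW => n /=; pose m := (maxn m0 n).+1.
have m0m : (m0 <= m)%N by rewrite leqW// leq_maxl.
have := memory_visit_bound R m0m; rewrite -lee_fin -run_law_visited -/P => /le_trans.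
apply; apply: le_measure; rewrite ?inE; first exact: measurable_prefix.
  exact: measurable_visits_from.
move=> rho /visited_prefix => /(_ (start_double_gt0 (ltn0Sn _)))[i [/andP[mi _] gi]].
exists i => //; apply: leq_trans mi.
by have := leq_start m; rewrite /m; lia.
Qed.

Lemma sup_buchi :
  ereal_sup [set run_law origin sigma (buchi origin goal_set)
            | sigma in [set: strategy M]] = 1.
Proof.
apply/eqP; rewrite eq_le; apply/andP; split.
  apply: ge_ereal_sup => _ [sigma _ <-]; apply: probability_le1.
  exact: measurable_buchi.
apply/lee_addgt0Pr => e e0.
have [n ne] : exists n, (2 * 2 ^- n <= e)%R.
  (* For this [n] one has [2 / e <= n <= 2 ^ n]. *)
  exists (Num.trunc (2 / e)).+1; rewrite ler_pdivrMr ?exprn_gt0// mulrC.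
  rewrite -ler_pdivrMr// (le_trans (ltW (truncnS_gt _)))//.
  by rewrite -natrX ler_nat ltnW// ltn_expl.
apply: (@le_trans _ _ ((1 - 2 * 2 ^- n)%:E + e%:E)).
  by rewrite -EFinD lee_fin; lra.
rewrite leeD2r//; apply: le_trans (memory_buchi n) _.
by apply: ereal_sup_ubound; exists (memory_strategy R n).
Qed.

End events.

Theorem proposition22 (R : realType) :
  exists (M : mdp R) (s0 : M) (F : set M),
    [/\ finitely_branching M,
        step_counter_implicit s0,
        (forall s t : M, trans s t ->
           reward s t = (if s \in F then 1 else -1)%R),
        ereal_sup [set run_law s0 sigma (buchi s0 F)
                  | sigma in [set: strategy M]] = 1 /\
        (forall sigma : strategy M, randomized_markov sigma ->
           run_law s0 sigma (buchi s0 F) = 0) &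
        ereal_sup [set run_law s0 sigma (limsup_ge0 s0)
                  | sigma in [set: strategy M]] = 1 /\
        (forall sigma : strategy M, randomized_markov sigma ->
           run_law s0 sigma (limsup_ge0 s0) = 0)].
Proof.
exists (example R), (origin R), (@goal_set R); rewrite limsup_ge0_buchi.
have io := conj (sup_buchi R) (@markov_buchi R).
split=> //; [exact: example_finitely_branching|exact: example_step_counter|].
move=> s t _ /=; congr (if _ then _ else _).
by apply/idP/idP => [/mem_set|/set_mem].
Qed.
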